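(* Let $X$ be a Banach space, let $A$ be the infinitesimal generator of a $C^0$-semigroup $(e^{tA})_{t\ge 0}$ of bounded linear operators on $X$, and let $p>1$ ($p=\infty$ allowed). Let $f_i:X\to X$, $i=1,\dots,m$, be continuous (autonomous) vector fields which are Lipschitz on bounded sets and linearly bounded. Then for all $\xi_0\in X$ the reachable set $\mathcal{R}^p(\xi_0)$ of $$\dot x(t)=Ax(t)+\sum_{i=1}^m u_i(t)f_i\big(x(t)\big),\qquad x(0)=\xi_0,\qquad u_i\in L^p_{\rm loc}([0,\infty),\mathbb{R}),$$ can be written as a countable union of relatively compact sets and has therefore no interior points if $X$ is infinite-dimensional.
   Context: $X$ is real or complex. A map $f:X\to X$ is Lipschitz on bounded sets if for every bounded $C\subset X$ there is $L\ge 0$ with $\|f(\xi)-f(\eta)\|\le L\|\xi-\eta\|$ for all $\xi,\eta\in C$; it is linearly bounded if there are $\alpha,\beta\ge 0$ with $\|f(\xi)\|\le\alpha\|\xi\|+\beta$ for all $\xi\in X$. A mild solution on $[0,T]$ for the control $u=(u_1,\dots,u_m)\in L^p([0,T],\mathbb{R}^m)$ is a continuous $x:[0,T]\to X$ with $x(t)=e^{tA}\xi_0+\sum_{i=1}^m\int_0^t e^{(t-s)A}u_i(s)f_i(x(s))\,ds$ for all $t\in[0,T]$ (Bochner integral). Under the stated hypotheses it exists and is unique, and is denoted $x(\cdot,\xi_0,u)$. The reachable set is $$\mathcal{R}^p(\xi_0):=\bigcup_{T\ge 0}\{x(t,\xi_0,u): t\in[0,T],\ u\in L^p([0,T],\mathbb{R}^m)\}.$$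 A set is relatively compact if its closure is compact. *)

(* Defs.v *)
From HB Require Import structures.
From mathcomp Require Export all_boot all_order all_algebra.
From mathcomp Require Export all_classical all_reals all_analysis.
From mathcomp Require Export complex.

Set Implicit Arguments.
Unset Strict Implicit.
Unset Printing Implicit Defensive.

Import Order.TTheory GRing.Theory Num.Theory.
Import numFieldNormedType.Exports.

Local Open Scope classical_set_scope.
Local Open Scope ring_scope.

Variant scalar_kind := RealScalars | ComplexScalars.

Definition scalar (R : realType) (k : scalar_kind) : numFieldType :=
  match k with
  | RealScalars => R
  | ComplexScalars => complex R
  end.

Definition of_real (R : realType) (k : scalar_kind) : R -> scalar R k :=
  match k return R -> scalar R k with
  | RealScalars => fun r => r
  | ComplexScalars => fun r => Complex r 0
  end.

Definition real_part (R : realType) (k : scalar_kind) : scalar R k -> R :=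
  match k return scalar R k -> R with
  | RealScalars => fun z => z
  | ComplexScalars => fun z => complex.Re z
  end.

Arguments of_real {R} k r.
Arguments real_part {R k} z.

(* The norm of a normed module over [scalar R k] takes its values in
   [scalar R k]; they are nonnegative reals there. *)
Definition rnorm (R : realType) (k : scalar_kind)
  (X : normedModType (scalar R k)) (x : X) : R := real_part `|x|.

Definition finite_dimensional (K : numFieldType) (X : lmodType K) : Prop :=
  exists (n : nat) (e : 'I_n -> X), forall x : X,
    exists c : 'I_n -> K, x = \sum_(i < n) c i *: e i.

Section Bochner.
Context (d : measure_display) (T : measurableType d) (R : realType).
Context (k : scalar_kind) (X : completeNormedModType (scalar R k)).
Variables (mu : {measure set T -> \bar R}) (D : set T).

(* A simple function [\sum_j 1_(A_j) v_j], given by the list of pairs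
   [(A_j, v_j)]; the sets need not be disjoint. *)
Definition simple_on (s : seq (set T * X)) : Prop :=
  {in s, forall av, measurable av.1 /\ (mu (D `&` av.1) < +oo)%E}.

Definition simple_eval (s : seq (set T * X)) (t : T) : X :=
  \sum_(av <- s) of_real k (\1_(av.1) t) *: av.2.

Definition simple_integral (s : seq (set T * X)) : X :=
  \sum_(av <- s) of_real k (fine (mu (D `&` av.1))) *: av.2.

Definition strongly_measurable (f : T -> X) : Prop :=
  exists s : nat -> seq (set T * X),
    (forall n, simple_on (s n)) /\
    {ae mu, forall t, D t -> simple_eval (s n) t @[n --> \oo] --> f t}.

Definition is_bochner_integral (f : T -> X) (v : X) : Prop :=
  strongly_measurable f /\
  exists s : nat -> seq (set T * X),
    [/\ forall n, simple_on (s n),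
        (\int[mu]_(t in D) (rnorm (f t - simple_eval (s n) t))%:E)%E
          @[n --> \oo] --> 0%E &
        simple_integral (s n) @[n --> \oo] --> v].

Definition bochner_integrable (f : T -> X) : Prop :=
  exists v, is_bochner_integral f v.

Definition bochner_integral (f : T -> X) : X :=
  xget 0 [set v | is_bochner_integral f v].

End Bochner.

Section ControlSystem.
Context (R : realType) (k : scalar_kind).
Variable X : completeNormedModType (scalar R k).

(* [S t] is meaningful for [t >= 0] only. *)
Definition C0_semigroup (S : R -> X -> X) : Prop :=
  [/\ forall t, 0 <= t -> linear (S t) /\
        exists M : scalar R k, forall x, `|S t x| <= M * `|x|,
      S 0 = id,
      forall s t, 0 <= s -> 0 <= t -> S (s + t) = S s \o S t &
      forall x, S t x @[t --> 0^'+] --> x].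

(* The unbounded operator with domain [domA], acting there as [A]. *)
Definition infinitesimal_generator (S : R -> X -> X)
    (domA : set X) (A : X -> X) : Prop :=
  let quotient x h := of_real k h^-1 *: (S h x - x) in
  domA = [set x | cvg (quotient x h @[h --> 0^'+])] /\
  forall x, domA x -> quotient x h @[h --> 0^'+] --> A x.

(* An order relation with a nonnegative element of [scalar R k] forces the
   other side to be real, so [L], [a] and [b] below are nonnegative reals. *)
Definition lipschitz_on_bounded_sets (f : X -> X) : Prop :=
  forall C : set X, bounded_set C ->
    exists2 L : scalar R k, 0 <= L & L.-lipschitz_C f.

Definition linearly_bounded (f : X -> X) : Prop :=
  exists a b : scalar R k,
    [/\ 0 <= a, 0 <= b & forall x, `|f x| <= a * `|x| + b].

Definition Lp_control (p : \bar R) (m : nat) (T : R) (u : 'I_m -> R -> R)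
    : Prop :=
  forall i, (u i \_ `[0, T]) \in Lfun (@lebesgue_measure R) p.

Definition mild_solution (S : R -> X -> X) (m : nat) (f : 'I_m -> X -> X)
    (xi0 : X) (T : R) (u : 'I_m -> R -> R) (x : R -> X) : Prop :=
  let integrand t i s := of_real k (u i s) *: S (t - s) (f i (x s)) in
  {within `[0, T], continuous x} /\
  forall t : R, t \in `[0, T] ->
    (forall i, bochner_integrable (@lebesgue_measure R) `[0, t]
                 (integrand t i)) /\
    x t = S t xi0 +
      \sum_(i < m) bochner_integral (@lebesgue_measure R) `[0, t]
                     (integrand t i).

Definition reachable_set (S : R -> X -> X) (p : \bar R) (m : nat)
    (f : 'I_m -> X -> X) (xi0 : X) : set X :=
  \bigcup_(T in [set T : R | 0 <= T])
    [set y | exists (u : 'I_m -> R -> R) (x : R -> X) (t : R),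
       [/\ Lp_control p T u, mild_solution S f xi0 T u x,
           t \in `[0, T] & y = x t]].

Definition relatively_compact (C : set X) : Prop := compact (closure C).

End ControlSystem.

(* Main.v *)
(* Let [V t] be the integral of [sum_i |u_i|] over [0, t].
   Fix a bound [N] on the time and on the trajectory, and let [Q_j] be the set of
   the points [x t] with [V t < j * delta]. By Duhamel's formula, [x t] is the sum
   of [S t xi0] and of the integrals of [u_i(s) S(t - s) f_i(x s)] over the times
   [s] with [V s < (j - 1) * delta] and over the remaining ones. If [Q_(j-1)] is
   totally bounded, then the first integral ranges over a totally bounded set,
   being a limit of combinations, with bounded weight, of points of the totally
   bounded set [S([0, N]) f_i(Q_(j-1))]. The second one has weight at most
   [delta], so when [Q_j] can be covered by finitely many balls of radius [r], the
   values of the second integral can be covered by finitely many balls of radius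
   [C * delta * r + epsilon], where [C] depends only on the semigroup on [0, N] and
   on the Lipschitz constants of the [f_i] on the ball of radius [N]. For [delta]
   small this halves the covering radius of [Q_j], which is therefore totally
   bounded, and induction on [j] applies.

   By Baire's theorem, a countable union of relatively compact sets with interior
   points yields a totally bounded ball, and then [X] is finite-dimensional. *)
Require Import Defs.
From mathcomp Require Import measurable_realfun ess_sup_inf ring lra.

Set Implicit Arguments.
Unset Strict Implicit.
Unset Printing Implicit Defensive.

Import Order.TTheory GRing.Theory Num.Theory.
Import numFieldNormedType.Exports.

Local Open Scope classical_set_scope.
Local Open Scope ring_scope.

(** * Real-valued norm on a real or complex normed module *)

Section Scalars.
Context (R : realType) (k : scalar_kind).

Lemma of_realD (a b : R) : of_real k (a + b) = of_real k a + of_real k b.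
Proof. by case: k => //=; rewrite /GRing.add /= addr0. Qed.

Lemma of_realM (a b : R) : of_real k (a * b) = of_real k a * of_real k b.
Proof.
by case: k => //=; rewrite {2}/GRing.mul /= mulr0 subr0 mulr0 mul0r addr0.
Qed.

Lemma of_real1 : of_real k (1 : R) = 1.
Proof. by case: k. Qed.

Lemma of_real0 : of_real k (0 : R) = 0.
Proof. by case: k. Qed.

Lemma of_realN (a : R) : of_real k (- a) = - of_real k a.
Proof. by case: k => //=; rewrite {2}/GRing.opp /= oppr0. Qed.

Lemma of_realK (a : R) : real_part (of_real k a) = a.
Proof. by case: k. Qed.

Lemma norm_of_real (a : R) : `|of_real k a| = of_real k `|a|.
Proof.
by case: k => //=; rewrite normc_def /= expr0n /= addr0 sqrtr_sqr.
Qed.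

Lemma ler_of_real (a b : R) : (of_real k a <= of_real k b) = (a <= b).
Proof. by case: k => //=; rewrite lecE /= eqxx. Qed.

Lemma ltr_of_real (a b : R) : (of_real k a < of_real k b) = (a < b).
Proof. by case: k => //=; rewrite ltcE /= eqxx. Qed.

Lemma real_partK (z : scalar R k) : 0 <= z -> of_real k (real_part z) = z.
Proof.
case: k z => //= -[a b]; rewrite lecE /= => /andP[/eqP -> _] //.
Qed.

End Scalars.

Section Rnorm.
Context (R : realType) (k : scalar_kind) (X : normedModType (scalar R k)).
Implicit Types x y : X.

Lemma of_real_rnorm x : of_real k (rnorm x) = `|x|.
Proof. exact: real_partK. Qed.

Lemma rnorm_ge0 x : 0 <= rnorm x.
Proof. by rewrite -(ler_of_real k) of_real_rnorm of_real0. Qed.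

Lemma rnorm0 : rnorm (0 : X) = 0.
Proof. by rewrite /rnorm normr0 -(of_real0 R k) of_realK. Qed.

Lemma rnorm0_eq0 x : rnorm x = 0 -> x = 0.
Proof.
by move=> x0; apply: normr0_eq0; rewrite -of_real_rnorm x0 of_real0.
Qed.

Lemma ler_rnormD x y : rnorm (x + y) <= rnorm x + rnorm y.
Proof. by rewrite -(ler_of_real k) of_realD !of_real_rnorm ler_normD. Qed.

Lemma rnormN x : rnorm (- x) = rnorm x.
Proof. by rewrite /rnorm normrN. Qed.

Lemma rnormB x y : rnorm (x - y) = rnorm (y - x).
Proof. by rewrite -rnormN opprB. Qed.

Lemma ler_rnorm_distD z x y : rnorm (x - y) <= rnorm (x - z) + rnorm (z - y).
Proof. by rewrite (le_trans _ (ler_rnormD _ _)) // addrA subrK. Qed.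

Lemma rnormZ (a : R) x : rnorm (of_real k a *: x) = `|a| * rnorm x.
Proof.
have := normrZ (of_real k a) x.
rewrite -!of_real_rnorm norm_of_real -of_realM => /(congr1 real_part).
by rewrite !of_realK.
Qed.

Lemma ler_rnorm_sum (I : Type) (r : seq I) (P : pred I) (F : I -> X) :
  rnorm (\sum_(i <- r | P i) F i) <= \sum_(i <- r | P i) rnorm (F i).
Proof.
elim/big_ind2 : _ => //[|x a y b xa yb]; first by rewrite rnorm0.
exact: le_trans (ler_rnormD _ _) (lerD xa yb).
Qed.

Lemma nbhs_rnormP x (A : set X) :
  nbhs x A <-> exists2 e : R, 0 < e & forall y, rnorm (x - y) < e -> A y.
Proof.
split=> [/nbhs_normP[e /= e0 eA]|[e e0 eA]].
  exists (real_part e).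
    by rewrite -(ltr_of_real k) of_real0 real_partK // ltW.
  move=> y xy; apply: eA => /=; rewrite -of_real_rnorm -(@real_partK _ _ e).
    by rewrite ltr_of_real.
  exact: ltW.
apply/nbhs_normP; exists (of_real k e); first by rewrite /= -(of_real0 R k) ltr_of_real.
by move=> y /=; rewrite -of_real_rnorm ltr_of_real; exact: eA.
Qed.

Lemma cvg_rnormP (F : set_system X) (FF : Filter F) x :
  F --> x <-> forall e : R, 0 < e -> \forall y \near F, rnorm (x - y) < e.
Proof.
split=> [Fx e e0|H A /nbhs_rnormP[e e0 eA]].
  by apply: Fx; apply/nbhs_rnormP; exists e.
by apply: filterS eA _; exact: H.
Qed.

Lemma cvgn_rnormP (u : nat -> X) x :
  u @ \oo --> x <->
  forall e : R, 0 < e -> exists N, forall n, (N <= n)%N -> rnorm (x - u n) < e.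
Proof.
split=> [ux e e0|H].
  by have /cvg_rnormP /(_ e e0)[N _ HN] := ux; exists N => n Nn; exact: HN.
apply/cvg_rnormP => e e0; have [N HN] := H e e0.
by exists N => // n /= Nn; exact: HN.
Qed.

End Rnorm.

Section Complete.
Context (R : realType) (k : scalar_kind).
Variable X : completeNormedModType (scalar R k).

Lemma rnorm_cauchy_cvg (F : set_system X) (FF : ProperFilter F) :
  (forall e : R, 0 < e -> exists x, F [set y | rnorm (x - y) < e]) -> cvg F.
Proof.
move=> H; apply: cauchy_cvg; apply: cauchy_exP => e e0.
have e0' : 0 < real_part e.
  by rewrite -(ltr_of_real k) of_real0 real_partK // ltW.
have [x Fx] := H _ e0'; exists x; apply: filterS Fx => y /= xy.
by rewrite -ball_normE /= -of_real_rnorm -(real_partK (ltW e0)) ltr_of_real.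
Qed.

Lemma rnorm_cauchy_seq_cvg (u : nat -> X) :
  (forall e : R, 0 < e -> exists N, forall n, (N <= n)%N -> rnorm (u N - u n) < e) ->
  exists x : X, u @ \oo --> x.
Proof.
move=> H; suff /cvg_ex : cvg (u @ \oo) by [].
apply: rnorm_cauchy_cvg => e e0.
have [N HN] := H e e0; exists (u N), N => // n /= Nn; exact: HN.
Qed.

End Complete.

(** * Category, total boundedness and finite dimension *)

Lemma geometric_half_small (R : realType) (a e : R) : 0 < e ->
  exists N, forall n, (N <= n)%N -> a * 2^-1 ^+ n < e.
Proof.
move=> e0; have : a * 2^-1 ^+ n @[n --> \oo] --> (0 : R).
  rewrite -[X in _ --> X](mulr0 a); apply: cvgMr; apply: cvg_expr.
  by rewrite ger0_norm // invf_lt1 // ltr1n.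
move=> /cvgrPdist_lt /(_ e e0)[N _ HN]; exists N => n Nn.
by have := HN n Nn; rewrite /= sub0r normrN; exact: le_lt_trans (ler_norm _).
Qed.

Lemma cvgn_sum (R : realType) (I : Type) (s : seq I) (f : I -> nat -> R)
    (l : I -> R) : (forall i, f i n @[n --> \oo] --> l i) ->
  \sum_(i <- s) f i n @[n --> \oo] --> \sum_(i <- s) l i.
Proof.
move=> fl; elim: s => [|i s IH].
  by rewrite big_nil; under eq_cvg do rewrite big_nil; exact: cvg_cst.
by rewrite big_cons; under eq_cvg do rewrite big_cons; exact: cvgD.
Qed.

Section Baire.
Context (R : realType) (k : scalar_kind).
Variable X : completeNormedModType (scalar R k).
Implicit Types x y z : X.

Lemma Baire_closed_cover (F : nat -> set X) (O : set X) :
  (forall n, closed (F n)) -> open O -> O !=set0 -> O `<=` \bigcup_n F n ->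
  exists n x (r : R), 0 < r /\ forall y, rnorm (x - y) < r -> F n y.
Proof.
move=> clF opO [x0 Ox0] OF; apply: contrapT => noint.
have step (a : nat * (X * R)) : exists b : X * R, 0 < a.2.2 ->
    [/\ 0 < b.2, b.2 <= a.2.2 / 2 & forall z, rnorm (b.1 - z) <= b.2 ->
      rnorm (a.2.1 - z) <= a.2.2 /\ ~ F a.1 z].
  case: a => n [x r] /=.
  have [r0|_] := ltP 0 r; last by exists (x, r).
  have [y xy nFy] : exists2 y, rnorm (x - y) < r / 2 & ~ F n y.
    apply: contrapT => H; apply: noint; exists n, x, (r / 2); split; first lra.
    by move=> y xy; apply: contrapT => nFy; apply: H; exists y.
  have /nbhs_rnormP[e e0 He] : nbhs y (~` F n).
    by apply: open_nbhs_nbhs; split => //; exact: closed_openC.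
  exists (y, Num.min (e / 2) (r / 2)) => _ /=; split.
  - by rewrite lt_min; apply/andP; split; lra.
  - by rewrite ge_min lexx orbT.
  - move=> z; rewrite le_min => /andP[ye yr]; split; last by apply: He; lra.
    by have := ler_rnorm_distD y x z; lra.
have [f Hf] := choice step.
have /nbhs_rnormP[e0 e00 He0] : nbhs x0 O by apply: open_nbhs_nbhs.
pose fix s n : X * R := if n is m.+1 then f (m, s m) else (x0, e0 / 2).
have s_gt0 n : 0 < (s n).2.
  by elim: n => [/=|n /(Hf (n, s n))[]//]; lra.
have s_step n := Hf (n, s n) (s_gt0 n).
have s_mono n z : rnorm ((s n.+1).1 - z) <= (s n.+1).2 ->
    rnorm ((s n).1 - z) <= (s n).2 /\ ~ F n z.
  by have [_ _ H] := s_step n; exact: H.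
have s_small n : (s n).2 <= e0 * 2^-1 ^+ n.
  elim: n => [/=|n IH]; first by rewrite expr0; lra.
  by have [_ + _] := s_step n; rewrite -/(s n.+1) exprS /=; lra.
have s_in n m : (n <= m)%N -> forall z, rnorm ((s m).1 - z) <= (s m).2 ->
    rnorm ((s n).1 - z) <= (s n).2.
  move=> /subnKC <-; elim: (m - n)%N => [z|i IH z]; first by rewrite addn0.
  by rewrite addnS => /s_mono[/IH].
have s_dist n m : (n <= m)%N -> rnorm ((s n).1 - (s m).1) <= (s n).2.
  by move=> nm; apply: s_in nm _ _; rewrite subrr rnorm0 ltW.
have [l /cvgn_rnormP sl] : exists l : X, (fun n => (s n).1) @ \oo --> l.
  apply: rnorm_cauchy_seq_cvg => e /(geometric_half_small e0)[N HN].
  exists N => n Nn; apply: le_lt_trans (s_dist _ _ Nn) _.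
  exact: le_lt_trans (s_small N) (HN _ _).
have l_in n : rnorm ((s n).1 - l) <= (s n).2.
  apply/ler_addgt0Pr => e /sl[N HN].
  have := HN _ (leq_maxl N n); have := s_dist _ _ (leq_maxr N n).
  by rewrite (rnormB l); have := ler_rnorm_distD (s (maxn N n)).1 (s n).1 l; lra.
have Ol : O l by apply: He0; have := l_in 0%N => /=; lra.
by have [n _ Fnl] := OF _ Ol; have [] := s_mono n l (l_in n.+1).
Qed.

End Baire.

Section Covering.
Context (R : realType) (k : scalar_kind).
Variable X : completeNormedModType (scalar R k).
Implicit Types (Q : set X) (x y z : X).

Definition covered Q (r : R) := exists F : seq X,
  forall x, Q x -> exists2 y, y \in F & rnorm (x - y) <= r.

Definition totally_bounded Q := forall r, 0 < r -> covered Q r.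

Lemma closure_rnormP Q x :
  closure Q x -> forall e : R, 0 < e -> exists2 y, Q y & rnorm (x - y) < e.
Proof.
move=> Qx e e0; have [|y [Qy xy]] := Qx [set y | rnorm (x - y) < e].
  by apply/nbhs_rnormP; exists e.
by exists y.
Qed.

Lemma totally_bounded_relatively_compact Q :
  totally_bounded Q -> relatively_compact Q.
Proof.
move=> tQ; rewrite /relatively_compact compact_ultra => U UU UQ.
have cQ (r : R) : 0 < r -> exists x, U [set y | rnorm (x - y) < r].
  move=> r0; have [|F FQ] := tQ (r / 2); first lra.
  have : U [set y | exists2 x, x \in F & rnorm (x - y) < r].
    apply: filterS UQ => y /closure_rnormP /(_ (r / 2)) [|z /FQ[x xF zx] yz]; first lra.
    exists x => //.
    by rewrite rnormB; have := ler_rnorm_distD z y x; lra.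
  elim: (F) => [|a F' IH]; first by move=> /filter_ex[y []].
  have [Ua _|Ua H] := in_ultra_setVsetC [set y | rnorm (a - y) < r] UU.
    by exists a.
  apply: IH; apply: filterS (filterI Ua H) => y [/= nay [x]].
  by rewrite inE => /orP[/eqP->//|xF xy]; exists x.
have [p Up] : exists p : X, U --> p by exists (lim U); exact: rnorm_cauchy_cvg cQ.
exists p; split => //.
apply: (@closed_closure _ Q).
by move=> B /Up UB; apply: filter_ex (filterI UQ UB).
Qed.

Lemma open_rball x (r : R) : open [set y | rnorm (x - y) < r].
Proof.
rewrite openE => y /= xy; apply/nbhs_rnormP; exists (r - rnorm (x - y)); first lra.
by move=> z yz /=; have := ler_rnorm_distD y x z; lra.
Qed.

Lemma relatively_compact_totally_bounded Q :
  relatively_compact Q -> totally_bounded (closure Q).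
Proof.
move=> + r r0; rewrite /relatively_compact compact_cover.
move=> /(_ X setT (fun x => [set y | rnorm (x - y) < r])).
case=> [x _|x Qx|F _ QF]; first exact: open_rball.
  by exists x => //=; rewrite subrr rnorm0.
exists (finmap.enum_fset F) => x /QF[y /= yF yx]; exists y => //.
by rewrite rnormB ltW.
Qed.

(* If [F] is an [r/4]-net of the ball [B(0, r)], every [x] in it is [y + x'/2]
   with [y] in [F] and [x'] in [B(0, r)]; iterating, [x = sum_j 2^-j y_j] with all
   [y_j] in [F], so that [F] spans [X]. *)
Lemma totally_bounded_ball_finite_dimensional Q x0 (r : R) : 0 < r ->
  (forall y, rnorm (x0 - y) < r -> Q y) -> totally_bounded Q ->
  finite_dimensional X.
Proof.
move=> r0 ballQ /(_ (r / 4)) [|F0 HF0]; first lra.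
pose F := [seq y - x0 | y <- F0].
have /choice[phi Hphi] : forall x, exists y,
    rnorm x < r -> y \in F /\ rnorm (x - y) <= r / 4.
  move=> x; have [xr|_] := ltP (rnorm x) r; last by exists 0.
  have [|y yF xy] := HF0 (x + x0).
    by apply: ballQ; rewrite rnormB addrK.
  exists (y - x0) => _; split; first by apply/map_f.
  by rewrite opprB addrA.
exists (size F), (fun i => F`_i).
have small x : rnorm x < r -> exists c : 'I_(size F) -> scalar R k,
    x = \sum_i c i *: F`_i.
  move=> xr; pose T z := of_real k 2 *: (z - phi z).
  pose s n := iter n T x.
  have sr n : rnorm (s n) < r.
    elim: n => [//|n IH]; rewrite [s n.+1]iterS -/(s n) rnormZ ger0_norm //.
    by have [_] := Hphi _ IH; lra.
  pose idx n := index (phi (s n)) F.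
  have idxF n : phi (s n) = F`_(idx n).
    by rewrite nth_index //; have [] := Hphi _ (sr n).
  have idx_lt n : (idx n < size F)%N by rewrite index_mem; have [] := Hphi _ (sr n).
  pose c n (i : 'I_(size F)) : R := \sum_(j < n) 2^-1 ^+ j * (idx j == i)%:R.
  have expand n : x = \sum_i of_real k (c n i) *: F`_i + of_real k (2^-1 ^+ n) *: s n.
    elim: n => [|n IH].
      rewrite expr0 of_real1 scale1r big1 ?add0r // => i _.
      by rewrite /c big_ord0 of_real0 scale0r.
    have -> : s n.+1 = of_real k 2 *: (s n - phi (s n)) by [].
    rewrite [LHS]IH /c; under [in RHS]eq_bigr do
      rewrite big_ord_recr /= of_realD scalerDl.
    rewrite big_split /= -addrA; congr (_ + _).
    rewrite (bigD1 (Ordinal (idx_lt n))) //= eqxx mulr1 big1 => [|i ni]; last first.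
      by rewrite eq_sym -(inj_eq val_inj) /= in ni; rewrite (negbTE ni) mulr0 of_real0 scale0r.
    rewrite addr0 -idxF scalerA -of_realM exprS mulrAC mulVf // mul1r.
    by rewrite -scalerDr addrC subrK.
  have /choice[c0 Hc0] : forall i, exists l : R, c n i @[n --> \oo] --> l.
    move=> i; suff /cvg_ex : cvg (c n i @[n --> \oo]) by [].
    apply: nondecreasing_is_cvgn.
      apply/nondecreasing_seqP => n; rewrite /c big_ord_recr /= lerDl.
      by rewrite mulr_ge0 // exprn_ge0.
    exists 2 => _ [n _ <-].
    have : c n i <= \sum_(j < n) 2^-1 ^+ j.
      apply: ler_sum => j _; rewrite ler_piMr ?exprn_ge0 //; by case: eqP.
    move=> /le_trans; apply.
    suff -> : \sum_(j < n) 2^-1 ^+ j = 2 - 2 * 2^-1 ^+ n :> R.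
      by rewrite lerBlDr lerDl mulr_ge0 // exprn_ge0.
    elim: n => [|n IH]; first by rewrite big_ord0 expr0; lra.
    by rewrite big_ord_recr /= IH exprS; field.
  exists (fun i => of_real k (c0 i)); apply/eqP; rewrite -subr_eq0; apply/eqP.
  apply: rnorm0_eq0; apply/eqP; rewrite eq_le rnorm_ge0 andbT.
  pose h n := \sum_i `|c n i - c0 i| * rnorm F`_i + r * 2^-1 ^+ n.
  have hx n : rnorm (x - \sum_i of_real k (c0 i) *: F`_i) <= h n.
    rewrite {1}(expand n) addrAC -sumrB (le_trans (ler_rnormD _ _)) // lerD //.
      rewrite (le_trans (ler_rnorm_sum _ _ _)) // ler_sum // => i _.
      by rewrite -scalerBl -of_realN -of_realD rnormZ.
    by rewrite rnormZ ger0_norm ?exprn_ge0 // mulrC ler_wpM2r ?exprn_ge0 // ltW.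
  have h0 : h n @[n --> \oo] --> (0 : R).
    rewrite -[X in _ --> X]addr0; apply: cvgD.
      have e0 : \sum_(i < size F) `|c0 i - c0 i| * rnorm F`_i = 0 :> R.
        by apply: big1 => i _; rewrite subrr normr0 mul0r.
      rewrite -[X in _ --> X]e0; apply: cvgn_sum => i.
      apply: cvgMl; apply: cvg_norm; apply: cvgB => //.
      exact: cvg_cst.
    rewrite -[X in _ --> X](mulr0 r); apply: cvgMr; apply: cvg_expr.
    by rewrite ger0_norm // invf_lt1 // ltr1n.
  rewrite -(cvg_lim _ h0) //; apply: limr_ge; last exact: nearW.
  by apply/cvg_ex; exists 0.
move=> x; pose a := rnorm x / r + 1.
have a0 : 0 < a by rewrite ltr_wpDl // divr_ge0 ?rnorm_ge0 // ltW.
have [|c Hc] := small (of_real k a^-1 *: x).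
  rewrite rnormZ ger0_norm ?invr_ge0 ?ltW // mulrC ltr_pdivrMr // /a mulrDr.
  by rewrite mulrCA divff ?gt_eqF // !mulr1 ltrDl.
exists (fun i => of_real k a * c i).
have -> : x = of_real k a *: (of_real k a^-1 *: x).
  by rewrite scalerA -of_realM mulfV ?gt_eqF // of_real1 scale1r.
by rewrite Hc scaler_sumr; apply: eq_bigr => i _; rewrite scalerA.
Qed.

Lemma interior_bigcup_relatively_compact (C : nat -> set X) :
  (forall n, relatively_compact (C n)) -> ~ finite_dimensional X ->
  (\bigcup_n C n)° = set0.
Proof.
move=> rcC nfd; apply/eqP; apply: contrapT => /negP/set0P intC; apply: nfd.
have [||||n [x [r [r0 xr]]]] := @Baire_closed_cover _ _ X (fun n => closure (C n))
  (\bigcup_n C n)°.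
- by move=> n; exact: closed_closure.
- exact: open_interior.
- exact: intC.
- by move=> x /interior_subset [n _ Cnx]; exists n => //; exact: subset_closure.
apply: totally_bounded_ball_finite_dimensional r0 xr _.
exact: relatively_compact_totally_bounded.
Qed.

End Covering.

(** * Strongly continuous semigroups *)

Section Semigroup.
Context (R : realType) (k : scalar_kind).
Variables (X : completeNormedModType (scalar R k)) (S : R -> X -> X).
Hypothesis hS : C0_semigroup S.
Implicit Types (x y : X) (t h : R).

Lemma semigroupD t x y : 0 <= t -> S t (x + y) = S t x + S t y.
Proof.
by case: hS => H _ _ _ /H[Sl _]; have := Sl 1 x y; rewrite !scale1r.
Qed.

Lemma semigroup0 t : 0 <= t -> S t 0 = 0.
Proof.
by move=> t0; apply: (addrI (S t 0)); rewrite -semigroupD // !addr0.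
Qed.

Lemma semigroupZ t a x : 0 <= t -> S t (a *: x) = a *: S t x.
Proof.
move=> t0; case: hS => /(_ t t0)[Sl _] _ _ _.
by have := Sl a x 0; rewrite semigroup0 // !addr0.
Qed.

Lemma semigroupB t x y : 0 <= t -> S t (x - y) = S t x - S t y.
Proof. by move=> t0; rewrite semigroupD // -scaleN1r semigroupZ // scaleN1r. Qed.

Lemma semigroup_add s t x : 0 <= s -> 0 <= t -> S (s + t) x = S s (S t x).
Proof. by case: hS => _ _ H _ s0 t0; rewrite H. Qed.

Lemma semigroup_bounded t : 0 <= t ->
  exists2 M : R, 0 <= M & forall x, rnorm (S t x) <= M * rnorm x.
Proof.
move=> t0; case: hS => /(_ t t0)[_ [M HM]] _ _ _.
exists `|real_part M| => // x.
have [->|x0] := eqVneq x 0; first by rewrite semigroup0 // rnorm0 mulr0.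
have nx0 : 0 < `|x| by rewrite normr_gt0.
have M0 : 0 <= M by rewrite -(pmulr_lge0 _ nx0) (le_trans _ (HM x)).
rewrite -(ler_of_real k) of_realM !of_real_rnorm ger0_norm ?real_partK //.
by rewrite -(ler_of_real k) of_real0 real_partK.
Qed.

Lemma semigroup_cvg0 x (e : R) : 0 < e ->
  exists2 d : R, 0 < d & forall h, 0 <= h -> h < d -> rnorm (S h x - x) < e.
Proof.
move=> e0; case: hS => _ S0 _ /(_ x)/cvg_rnormP/(_ e e0)/= [d d0 Hd].
exists d => // h; rewrite le_eqVlt => /orP[/eqP <- _|h0 hd].
  by rewrite S0 subrr rnorm0.
by rewrite rnormB; apply: Hd => //=; rewrite sub0r normrN gtr0_norm.
Qed.

Lemma semigroup_bounded_near0 : exists (d M : R),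
  [/\ 0 < d, 0 <= M &
      forall t x, 0 <= t -> t <= d -> rnorm (S t x) <= M * rnorm x].
Proof.
pose F n := [set x | forall t, 0 <= t -> t <= n.+1%:R^-1 -> rnorm (S t x) <= n%:R].
have [|||n [x0 [r [r0 ballF]]]] := @Baire_closed_cover R k X F setT _ openT.
- move=> n x clx t t0 tn; have [M M0 HM] := semigroup_bounded t0.
  apply/ler_addgt0Pr => e e0.
  have M1 : 0 < M + 1 by lra.
  have [|y /(_ t t0 tn) Fy xy] := closure_rnormP clx (e := e / (M + 1)).
    by rewrite divr_gt0.
  rewrite -[x](subrK y) semigroupD // (le_trans (ler_rnormD _ _)) // addrC lerD //.
  rewrite (le_trans (HM _)) //.
  have : rnorm (x - y) * (M + 1) < e by rewrite -ltr_pdivlMr.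
  have := rnorm_ge0 (x - y); nra.
- by exists 0.
- move=> x _; have [d d0 Hd] := semigroup_cvg0 x ltr01.
  exists (Num.truncn (rnorm x + 1) + Num.truncn d^-1).+1 => // t t0 tn.
  have tD : t < d.
    apply: le_lt_trans tn _; rewrite invf_plt ?posrE //.
    apply: lt_le_trans (Num.Theory.truncnS_gt d^-1) _.
    by rewrite ler_nat !ltnS leqW // leq_addl.
  have := Hd t t0 tD; have := ler_rnormD (S t x - x) x; rewrite subrK.
  have := Num.Theory.truncnS_gt (rnorm x + 1).
  have : (Num.truncn (rnorm x + 1)).+1%:R <= (Num.truncn (rnorm x + 1) + Num.truncn d^-1).+1%:R :> R.
    by rewrite ler_nat ltnS leq_addr.
  lra.
exists n.+1%:R^-1, (4 * n%:R / r); split => //.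
  by rewrite divr_ge0 ?mulr_ge0 // ltW.
move=> t x t0 tn; have [->|xN0] := eqVneq x 0.
  by rewrite semigroup0 // rnorm0 mulr0.
have nx : 0 < rnorm x.
  rewrite lt_def rnorm_ge0 andbT; apply/eqP => /rnorm0_eq0 /eqP.
  exact/negP.
pose a := r / 2 / rnorm x; have a0 : 0 < a by rewrite !divr_gt0.
have Fx0 : F n x0 by apply: ballF; rewrite subrr rnorm0.
have Fax : F n (x0 + of_real k a *: x).
  apply: ballF; rewrite opprD addNKr rnormN rnormZ gtr0_norm // /a.
  by rewrite divfK ?gt_eqF //; lra.
have : rnorm (S t (of_real k a *: x)) <= n%:R + n%:R.
  rewrite -{1}[_ *: x](addKr x0) addrC semigroupB //.
  rewrite (le_trans (ler_rnormD _ _)) // rnormN lerD //.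
    exact: Fax.
  exact: Fx0.
rewrite semigroupZ // rnormZ gtr0_norm // -ler_pdivlMl // => /le_trans; apply.
have -> : 4 * n%:R / r * rnorm x = a^-1 * (n%:R + n%:R) => //.
by rewrite /a; field; rewrite !gt_eqF.
Qed.

Lemma semigroup_bounded_segment (T : R) : exists2 M : R, 1 <= M &
  forall t x, 0 <= t -> t <= T -> rnorm (S t x) <= M * rnorm x.
Proof.
have [d [M [d0 M0 HM]]] := semigroup_bounded_near0.
have H j t x : 0 <= t -> t <= j%:R * d -> rnorm (S t x) <= (M + 1) ^+ j * rnorm x.
  elim: j t x => [|j IH] t x t0.
    rewrite mul0r => t0'; have -> : t = 0 by lra.
    by case: hS => _ -> _ _; rewrite expr0 mul1r.
  rewrite -natr1 mulrDl mul1r => td; have [td1|dt] := leP t d.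
    apply: le_trans (HM t x t0 td1) _; rewrite ler_wpM2r ?rnorm_ge0 //.
    have : 1 <= (M + 1) ^+ j by rewrite exprn_ege1 //; lra.
    by rewrite exprS; nra.
  rewrite -(subrK d t) semigroup_add; [|lra..].
  apply: le_trans (IH _ _ _ _) _; [lra|lra|].
  rewrite exprSr -mulrA ler_wpM2l ?exprn_ge0 //; first lra.
  by apply: le_trans (HM d x (ltW d0) (lexx _)) _; have := rnorm_ge0 x; nra.
exists ((M + 1) ^+ (Num.truncn (T / d)).+1); first by rewrite exprn_ege1 //; lra.
move=> t x t0 tT; apply: H => //; apply: le_trans tT _.
by rewrite -ler_pdivrMr // ltW // Num.Theory.truncnS_gt.
Qed.

Lemma semigroup_dist (T M : R) :
  (forall t x, 0 <= t -> t <= T -> rnorm (S t x) <= M * rnorm x) ->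
  forall s t x, 0 <= s -> s <= t -> t <= T ->
  rnorm (S t x - S s x) <= M * rnorm (S (t - s) x - x).
Proof.
move=> HM s t x s0 st tT.
have -> : S t x = S s (S (t - s) x) by rewrite -semigroup_add ?subr_ge0 // addrC subrK.
by rewrite -semigroupB //; apply: HM => //; lra.
Qed.

Lemma semigroup_unif_continuous (T : R) x (e : R) : 0 < e ->
  exists2 d : R, 0 < d & forall s t, 0 <= s -> s <= T -> 0 <= t -> t <= T ->
    `|s - t| < d -> rnorm (S s x - S t x) < e.
Proof.
move=> e0; have [M M1 HM] := semigroup_bounded_segment T.
have M0 : 0 < M by lra.
have [|d d0 Hd] := semigroup_cvg0 x (e := e / M); first by rewrite divr_gt0.
have H s t : 0 <= s -> s <= t -> t <= T -> t - s < d -> rnorm (S t x - S s x) < e.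
  move=> s0 st tT td; apply: le_lt_trans (semigroup_dist HM x s0 st tT) _.
  by rewrite mulrC -ltr_pdivlMr //; apply: Hd => //; lra.
exists d => // s t s0 sT t0 tT std; have [st|/ltW ts] := leP s t.
  by rewrite rnormB; apply: H => //; move: std; rewrite distrC ger0_norm //; lra.
by apply: H => //; move: std; rewrite ger0_norm //; lra.
Qed.

End Semigroup.

(** * Estimates for Bochner integrals *)

Section Sublinear.
Context (R : realType) (k : scalar_kind) (X : normedModType (scalar R k)).
Implicit Types (q : X -> R) (x y z w : X).

Definition sublinear q :=
  (forall x y, q (x + y) <= q x + q y) /\
  (forall (a : R) x, 0 <= a -> q (of_real k a *: x) = a * q x).

Definition linear_along q z :=
  forall (a : R) x, q (x + of_real k a *: z) = q x + a * q z.

Lemma sublinear_rnorm : sublinear (@rnorm R k X).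
Proof.
by split=> [|a x a0]; [exact: ler_rnormD|rewrite rnormZ ger0_norm].
Qed.

Lemma sublinear0 q : sublinear q -> q 0 = 0.
Proof. by move=> [_ /(_ 0 0 (lexx 0))]; rewrite of_real0 scale0r mul0r. Qed.

(* The functional [q' x = inf_(s >= 0) (q (x + s z) - s q z)] works. *)
Lemma sublinear_linearize q z : sublinear q -> exists q',
  [/\ sublinear q', forall x, q' x <= q x, linear_along q' z, q' z = q z &
      forall w, linear_along q w -> linear_along q' w /\ q' w = q w].
Proof.
move=> sq; have q0 := sublinear0 sq; case: sq => qD qZ.
pose E x := [set q (x + of_real k s *: z) - s * q z | s in [set s | 0 <= s]].
pose q' x := inf (E x).
have lbE x : lbound (E x) (- q (- x)).
  move=> _ [s /= s0 <-]; have := qD (- x) (x + of_real k s *: z).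
  by rewrite addKr qZ //; lra.
have infE x : has_inf (E x).
  split; last by exists (- q (- x)); exact: lbE.
  by exists (q (x + of_real k 0 *: z) - 0 * q z), 0 => //=.
have q'_le x s : 0 <= s -> q' x <= q (x + of_real k s *: z) - s * q z.
  by move=> s0; apply: ge_inf; [exact: (infE x).2|exists s].
have le_q' x c : (forall s, 0 <= s -> c <= q (x + of_real k s *: z) - s * q z) ->
    c <= q' x.
  by move=> H; apply: lb_le_inf; [exact: (infE x).1|move=> _ [s /= s0 <-]; exact: H].
have q'q x : q' x <= q x.
  by have := q'_le x 0 (lexx 0); rewrite of_real0 scale0r addr0 mul0r subr0.
have q'D x y : q' (x + y) <= q' x + q' y.
  suff : q' (x + y) - q' y <= q' x by lra.
  apply: (le_q') => s s0.
  suff : q' (x + y) - (q (x + of_real k s *: z) - s * q z) <= q' y by lra.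
  apply: (le_q') => t t0; have := q'_le (x + y) (s + t) (addr_ge0 s0 t0).
  have := qD (x + of_real k s *: z) (y + of_real k t *: z).
  by rewrite addrACA -scalerDl -of_realD; lra.
have q'Z_le a x : 0 < a -> q' (of_real k a *: x) <= a * q' x.
  move=> a0; rewrite -ler_pdivrMl //; apply: (le_q') => s s0.
  have as0 : 0 <= a * s by rewrite mulr_ge0 // ltW.
  rewrite ler_pdivrMl //; have := q'_le (of_real k a *: x) (a * s) as0.
  by rewrite of_realM -scalerA -scalerDr (qZ _ _ (ltW a0)) mulrBr mulrA.
have q'0 : q' 0 = 0.
  apply/eqP; rewrite eq_le (le_trans (q'q 0)) ?q0 //=.
  by apply: (le_q') => s s0; rewrite add0r qZ // subrr.
have q'Z a x : 0 <= a -> q' (of_real k a *: x) = a * q' x.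
  rewrite le_eqVlt => /orP[/eqP <-|a0]; first by rewrite of_real0 scale0r mul0r.
  apply/eqP; rewrite eq_le q'Z_le //= -ler_pdivlMl //.
  have := @q'Z_le a^-1 (of_real k a *: x).
  by rewrite scalerA -of_realM mulVf ?gt_eqF // of_real1 scale1r invr_gt0; apply.
have q'Nz : q' (- z) <= - q z.
  have := q'_le (- z) 1 ler01.
  by rewrite of_real1 scale1r addNr q0 mul1r sub0r.
have q'z : q' z = q z.
  apply/eqP; rewrite eq_le q'q /=; have := q'D z (- z).
  by rewrite subrr q'0; lra.
have lin_le a x : 0 <= a -> q' (x + of_real k a *: z) = q' x + a * q z.
  move=> a0; apply/eqP; rewrite eq_le -{1}q'z -q'Z // q'D /=.
  have := q'D (x + of_real k a *: z) (of_real k a *: - z).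
  rewrite q'Z // scalerN addrK => H; have : a * q' (- z) <= a * - q z by rewrite ler_wpM2l.
  by lra.
exists q'; split => //.
- move=> a x; rewrite q'z; have [a0|a0] := leP 0 a; first exact: lin_le.
  have := @lin_le (- a) (x + of_real k a *: z).
  by rewrite of_realN scaleNr addrK => /(_ _)->; [lra|lra].
- move=> w lw.
  have H a x : q' (x + of_real k a *: w) <= q' x + a * q w.
    suff : q' (x + of_real k a *: w) - a * q w <= q' x by lra.
    apply: (le_q') => s s0; have := q'_le (x + of_real k a *: w) s s0.
    by rewrite addrAC lw; lra.
  have H' a x : q' (x + of_real k a *: w) = q' x + a * q w.
    apply/eqP; rewrite eq_le H /=; have := H (- a) (x + of_real k a *: w).
    by rewrite of_realN scaleNr addrK; lra.
  have q'w : q' w = q w.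
    by have := H' 1 0; rewrite of_real1 scale1r !add0r q'0 mul1r add0r.
  by split => // a x; rewrite q'w.
Qed.

(* The Hahn-Banach theorem on the span of [ws], in a form that makes sense for
   both scalar fields: [q] is real-linear along each vector of [ws]. *)
Lemma norming_functional (ws : seq X) z : exists q,
  [/\ sublinear q, forall x, q x <= rnorm x, q z = rnorm z &
      {in ws, forall w, linear_along q w}].
Proof.
have [q1 [sq1 q1n lz q1z _]] := sublinear_linearize z sublinear_rnorm.
suff [q [sq qq1 lw Hq]] : exists q, [/\ sublinear q, forall x, q x <= q1 x,
    {in ws, forall w, linear_along q w} &
    forall w, linear_along q1 w -> linear_along q w /\ q w = q1 w].
  exists q; split => //.
    by move=> x; exact: le_trans (q1n x).
  by rewrite -q1z; have [] := Hq z lz.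
elim: ws => [|w ws [q [sq qq1 lws Hq]]]; first by exists q1; split.
have [q' [sq' q'q lw q'w Hq']] := sublinear_linearize w sq.
exists q'; split => //.
- by move=> x; exact: le_trans (qq1 x).
- by move=> x; rewrite inE => /orP[/eqP->//|/lws/Hq'[]].
- by move=> x /Hq[/Hq'[lx ->]].
Qed.

Lemma sublinear_sum q (I : eqType) (s : seq I) (c : I -> R) (w : I -> X) :
  sublinear q -> {in s, forall i, linear_along q (w i)} ->
  q (\sum_(i <- s) of_real k (c i) *: w i) = \sum_(i <- s) c i * q (w i).
Proof.
move=> sq; elim: s => [|i s IH] ls; first by rewrite !big_nil sublinear0.
rewrite !big_cons addrC ls ?mem_head // IH 1?addrC //.
by move=> j js; apply: ls; rewrite inE js orbT.
Qed.

End Sublinear.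

Section FiniteRank.
Context (d : measure_display) (T : measurableType d) (R : realType).
Context (mu : {measure set T -> \bar R}) (D : set T) (mD : measurable D).

(* The integral of a nonnegative function is defined as a supremum over the simple
   functions below it, even when the function is not measurable. *)
Lemma le_integral_nonmeasurable (h : T -> R) (g : T -> \bar R) :
  mu.-integrable D (EFin \o h) -> (forall t, D t -> 0 <= g t)%E ->
  (forall t, D t -> (h t)%:E <= g t)%E ->
  ((\int[mu]_(t in D) h t)%:E <= \int[mu]_(t in D) g t)%E.
Proof.
move=> ih g0 hg.
rewrite /Rintegral fineK; last exact: integrable_fin_num.
rewrite integralE (@le_trans _ _ (\int[mu]_(t in D) (EFin \o h)^\+ t)%E) //.
  rewrite leeBlDr; last first.
    by apply: integrable_neg_fin_num.
  by rewrite leeDl // integral_ge0.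
rewrite [leLHS]ge0_integralE; last by move=> t _; exact: funepos_ge0.
rewrite [leRHS]ge0_integralE //.
apply: ge_ereal_sup => _ [f /= hf <-]; apply: ereal_sup_ubound; exists f => //= t.
apply: le_trans (hf t) _; rewrite /patch; case: ifPn => // /set_mem Dt.
by rewrite funeposE ge_max; apply/andP; split; [exact: hg|exact: g0].
Qed.

Lemma Rintegral_sum (I : eqType) (s : seq I) (F : I -> T -> R) :
  {in s, forall i, mu.-integrable D (EFin \o F i)} ->
  mu.-integrable D (EFin \o (fun t => \sum_(i <- s) F i t)) /\
  \int[mu]_(t in D) (\sum_(i <- s) F i t) = \sum_(i <- s) \int[mu]_(t in D) F i t.
Proof.
elim: s => [_|i s IH iF].
  split; first by under eq_fun do rewrite big_nil; exact: integrable0.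
  by rewrite big_nil; under eq_Rintegral do rewrite big_nil;
    rewrite Rintegral_cst // mul0r.
have [|is_ es] := IH; first by move=> j js; apply: iF; rewrite inE js orbT.
have ii : mu.-integrable D (EFin \o F i) by apply: iF; rewrite mem_head.
split.
  by have := integrableD mD ii is_; apply: eq_integrable => // t _ /=;
    rewrite big_cons EFinD.
by rewrite big_cons -es -RintegralD //; apply: eq_Rintegral => t _; rewrite big_cons.
Qed.

Context (k : scalar_kind) (X : completeNormedModType (scalar R k)).

Lemma finite_rank_integral_le (L : seq ((T -> R) * X)) (lam : T -> \bar R)
    (psi : T -> R) :
  (forall l, l \in L -> mu.-integrable D (EFin \o l.1)) ->
  mu.-integrable D (EFin \o psi) ->
  (forall t, D t -> 0 <= lam t)%E ->
  (forall t, D t ->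
    (rnorm (\sum_(l <- L) of_real k (l.1 t) *: l.2) - psi t)%:E <= lam t)%E ->
  ((rnorm (\sum_(l <- L) of_real k (\int[mu]_(t in D) l.1 t) *: l.2) -
    \int[mu]_(t in D) psi t)%:E <= \int[mu]_(t in D) lam t)%E.
Proof.
move=> iL ipsi lam0 Hlam; set z := \sum_(l <- L) _.
have [q [sq qn qz ql]] := norming_functional [seq l.2 | l <- L] z.
have lL : {in L, forall l, linear_along q l.2} by move=> l lL; apply/ql/map_f.
have ilq l : l \in L -> mu.-integrable D (EFin \o (fun t => l.1 t * q l.2)).
  move=> /iL il; have := @integrableZr _ _ _ mu D mD (q l.2) _ il.
  by apply: eq_integrable => // t _ /=; rewrite EFinM.
have [iq eq_int] := Rintegral_sum ilq.
have {}eq_int : \int[mu]_(t in D) (\sum_(l <- L) l.1 t * q l.2) =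
    \sum_(l <- L) (\int[mu]_(t in D) l.1 t) * q l.2.
  by rewrite eq_int; apply: eq_big_seq => l /iL il; rewrite RintegralZr.
rewrite -qz sublinear_sum // -eq_int -RintegralB //.
apply: le_integral_nonmeasurable => //.
  have := integrableB mD iq ipsi; apply: eq_integrable => // t _ /=.
move=> t Dt; apply: le_trans (Hlam t Dt); rewrite lee_fin lerD2r.
by rewrite -sublinear_sum.
Qed.

Lemma bochner_integral_dist (g : T -> X) (v : X) (u : T -> R)
    (J : seq (set T * X)) (eta : R) :
  is_bochner_integral mu D g v -> mu.-integrable D (EFin \o u) ->
  (forall j, j \in J -> measurable j.1) -> 0 <= eta ->
  (forall t, D t ->
    rnorm (g t - \sum_(j <- J) of_real k (\1_(j.1) t * u t) *: j.2) <= eta * `|u t|) ->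
  rnorm (v - \sum_(j <- J) of_real k (\int[mu]_(t in D `&` j.1) u t) *: j.2) <=
    eta * \int[mu]_(t in D) `|u t|.
Proof.
move=> [_ [s [ss s0 sv]]] iu mJ eta0 Hg; set c := \sum_(j <- J) _.
have iabs : mu.-integrable D (EFin \o (fun t => `|u t|)).
  by have := integrable_abse iu; apply: eq_integrable.
have ipsi : mu.-integrable D (EFin \o (fun t => eta * `|u t|)).
  by have := integrableZl mD eta iabs; apply: eq_integrable => // t _ /=; rewrite EFinM.
have key n : ((rnorm (simple_integral mu D (s n) - c) -
     eta * \int[mu]_(t in D) `|u t|)%:E <=
   \int[mu]_(t in D) (rnorm (g t - simple_eval (s n) t))%:E)%E.
  rewrite -RintegralZl //.
  pose L := [seq (\1_(av.1) : T -> R, av.2) | av <- s n] ++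
    [seq ((fun t => - (\1_(j.1) t * u t)) : T -> R, j.2) | j <- J].
  have iJ j : j \in J -> mu.-integrable D (EFin \o (fun t => \1_(j.1) t * u t)) /\
     \int[mu]_(t in D) (\1_(j.1) t * u t) = \int[mu]_(t in D `&` j.1) u t.
    move=> jJ.
    have e t : \1_(j.1) t * u t = (u \_ j.1) t.
      by rewrite indicE /patch; case: ifP; rewrite (mul1r, mul0r).
    split; last by rewrite Rintegral_mkcondr; apply: eq_Rintegral => t _.
    apply: (@le_integrable _ _ _ mu D mD _ (EFin \o u)) => //.
      apply/measurable_EFinP; apply: measurable_funM; first exact: measurable_indic (mJ _ jJ).
      by apply/measurable_EFinP; exact: measurable_int iu.
    move=> t _ /=; rewrite lee_fin normrM ler_piMl //.
    by rewrite indicE; case: (_ \in _); rewrite ?normr1 ?normr0.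
  have is_ av : av \in s n -> mu.-integrable D (EFin \o (\1_(av.1) : T -> R)).
    move=> /(ss n)[mA Aoo]; apply/integrableP; split.
      exact/measurable_EFinP/measurable_indic.
    rewrite (eq_integral (fun t => (\1_(av.1) t)%:E)) => [|t _ /=].
      by rewrite integral_indic // setIC.
    by rewrite ger0_norm.
  have /(_ L) := finite_rank_integral_le _ ipsi.
  have -> : \sum_(l <- L) of_real k (\int[mu]_(t in D) l.1 t) *: l.2 =
      simple_integral mu D (s n) - c.
    rewrite big_cat !big_map /= -sumrN; congr (_ + _).
      apply: eq_big_seq => av /(ss n)[mA _]; congr (of_real _ _ *: _).
      by rewrite /Rintegral integral_indic // setIC.
    apply: eq_big_seq => j jJ; have [ij ej] := iJ j jJ.
    rewrite -ej -scaleNr -of_realN; congr (of_real _ _ *: _).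
    rewrite -[RHS]mulN1r -RintegralZl //.
    by apply: eq_Rintegral => t _; rewrite mulN1r.
  apply=> [l|t Dt|t Dt].
  - rewrite mem_cat => /orP[/mapP[av avs ->]|/mapP[j jJ ->]]; first exact: is_.
    have [ij _] := iJ j jJ; have := integrableN ij.
    by apply: eq_integrable.
  - by rewrite lee_fin rnorm_ge0.
  have -> : \sum_(l <- L) of_real k (l.1 t) *: l.2 =
      simple_eval (s n) t - \sum_(j <- J) of_real k (\1_(j.1) t * u t) *: j.2.
    rewrite big_cat !big_map /= -sumrN; congr (_ + _).
    by apply: eq_bigr => j _; rewrite of_realN scaleNr.
  rewrite lee_fin; have := Hg t Dt.
  by have := ler_rnorm_distD (g t) (simple_eval (s n) t)
    (\sum_(j <- J) of_real k (\1_(j.1) t * u t) *: j.2);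
    rewrite (rnormB (simple_eval (s n) t) (g t)); lra.
have rv e : 0 < e -> rnorm (v - c) <= eta * \int[mu]_(t in D) `|u t| + e.
  move=> e0; have /cvg_rnormP/(_ (e / 2)) sv2 := sv.
  have /s0 : nbhs (0%E : \bar R) [set x | (x < (e / 2)%:E)%E].
    by apply: open_ereal_lt'; rewrite lte_fin; lra.
  move=> [N1 _ H1]; have [|N2 _ H2] := sv2; first lra.
  have := H1 _ (leq_maxl N1 N2); have := H2 _ (leq_maxr N1 N2) => /= h2 h1.
  have := le_lt_trans (key (maxn N1 N2)) h1; rewrite lte_fin.
  have := ler_rnorm_distD (simple_integral mu D (s (maxn N1 N2))) v c; lra.
by apply/ler_addgt0Pr.
Qed.

End FiniteRank.

(** * Controls and Riemann sums of mild solutions *)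

Section LpControl.
Context (R : realType).
Notation mu := (@lebesgue_measure R).

Lemma Lp_control_integrable (p : \bar R) (m : nat) (T : R)
    (u : 'I_m -> R -> R) (i : 'I_m) : (1 < p)%E -> Lp_control p T u ->
  mu.-integrable `[0, T] (EFin \o u i).
Proof.
move=> p1 /(_ i); set v := u i \_ `[0, T].
set D := [set` `[0, T]] : set R.
have mD : measurable D by exact: measurable_itv.
have Doo : (mu D < +oo)%E.
  rewrite /D lebesgue_measure_itv /=; case: ifP => _ //=.
  by rewrite -EFinB ltry.
have iD c : mu.-integrable D (EFin \o cst (c : R)).
  apply/integrableP; split; first exact/measurable_EFinP/measurable_cst.
  rewrite (eq_integral (cst `|c|%:E)) // integral_cst //.
  by rewrite lte_mul_pinfty.
suff : v \in Lfun mu p -> mu.-integrable D (EFin \o v).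
  move=> H /H; apply: eq_integrable => // t tD /=.
  by rewrite /v /patch tD.
case: p p1 => [r||//] r1 vL.
  have mv : measurable_fun setT v by move: vL; rewrite inE => /andP[/[!inE]/=].
  have iv := @Lfun_integrable _ _ _ mu v r (ltW r1) vL.
  have ivD : mu.-integrable D (fun x => (`|v x| `^ r)%:E).
    by apply: integrableS iv.
  apply: (@le_integrable _ _ _ mu D mD _ (fun x => ((`|v x| `^ r)%:E + 1)%E)).
  - by apply/measurable_EFinP; apply: measurable_funTS.
  - move=> x _ /=; rewrite !lee_fin.
    have p0 := powR_ge0 `|v x| r.
    rewrite [leRHS]ger0_norm ?addr_ge0 //.
    have [v1|v1] := leP `|v x| 1; first by lra.
    suff : `|v x| <= `|v x| `^ r by lra.
    by rewrite -{1}(powRr1 (ltW (lt_trans ltr01 v1))) ler_powR // ltW.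
  - by apply: integrableD => //; exact: iD.
have mv : measurable_fun setT v by move: vL; rewrite inE => /andP[/[!inE]/=].
have : (ess_sup mu (abse \o (EFin \o v)) < +oo)%E.
  move: vL; rewrite inE => /andP[_]; rewrite inE /= /finite_norm unlock.
  suff -> : (0 < lebesgue_measure [set: R])%E by [].
  by rewrite -(@set_itvNyy _ R) lebesgue_measure_itv /= addye // ltry.
move=> vy; have [c c0 vc] : exists2 c : R, 0 <= c &
    \forall x \ae mu, (abse (EFin (v x)) <= c%:E)%E.
  exists (Num.max (fine (ess_sup mu (abse \o (EFin \o v)))) 0).
    by rewrite le_max lexx orbT.
  apply: filterS (ess_sup_ge mu (abse \o (EFin \o v))) => x.
  case: (ess_sup _ _) vy => [c|//|] _ /=; last by rewrite leeNy_eq.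
  by rewrite !lee_fin le_max => ->.
apply/integrableP; split; first by apply/measurable_EFinP/measurable_funTS.
apply: le_lt_trans (_ : (\int[mu]_(x in D) c%:E < +oo)%E); last first.
  by rewrite integral_cst // lte_mul_pinfty.
apply: ae_ge0_le_integral => //.
  by apply: measurableT_comp => //; apply/measurable_EFinP/measurable_funTS.
by apply: (@filterS _ _ (ae_filter_ringOfSetsType _) _ _ _ vc) => x.
Qed.

End LpControl.

Lemma unif_continuous_segment (R : realType) (k : scalar_kind)
    (X : normedModType (scalar R k)) (g : R -> X) (t : R) :
  (forall s, 0 <= s -> s <= t -> forall e : R, 0 < e -> exists2 d : R, 0 < d &
    forall s', 0 <= s' -> s' <= t -> `|s - s'| < d -> rnorm (g s' - g s) < e) ->
  forall e : R, 0 < e -> \forall h \near 0^'+, forall s s',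
    0 <= s -> s <= t -> 0 <= s' -> s' <= t -> `|s - s'| < h -> rnorm (g s - g s') < e.
Proof.
move=> gc e e0.
have /compact_near_coveringP/near_covering_withinP := @segment_compact R 0 t.
move=> /(_ R 0^'+ (fun h s => forall s', 0 <= s' -> s' <= t ->
  `|s - s'| < h -> rnorm (g s - g s') < e) _) near_cov.
have {}near_cov : \forall h \near 0^'+, `[0, t]%classic `<=`
    (fun s => forall s', 0 <= s' -> s' <= t -> `|s - s'| < h -> rnorm (g s - g s') < e).
  apply: near_cov => s; rewrite /= in_itv /= => /andP[s0 st].
  have [|d d0 Hd] := gc s s0 st (e / 2); first lra.
  exists ([set s' | `|s - s'| < d / 2], [set h | h < d / 2]) => /=.
    split; last by apply: nbhs_right_lt; lra.
    by apply/nbhs_ballP; exists (d / 2) => //=; lra.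
  move=> [s' h] /= [ss' hd]; rewrite in_itv /= => /andP[s'0 s't] s'' s''0 s''t s's''.
  have dd := ler_distD s' s s''.
  have h1 : rnorm (g s'' - g s) < e / 2 by apply: Hd => //; lra.
  have h2 : rnorm (g s' - g s) < e / 2 by apply: Hd => //; lra.
  by have := ler_rnorm_distD (g s) (g s') (g s''); rewrite (rnormB (g s) (g s'')); lra.
apply: filterS near_cov => h Hh s s' s0 st; apply: Hh.
by rewrite /= in_itv /= s0 st.
Qed.

Section MildSolution.
Context (R : realType) (k : scalar_kind).
Variables (X : completeNormedModType (scalar R k)) (S : R -> X -> X).
Hypothesis hS : C0_semigroup S.
Variables (m : nat) (f : 'I_m -> X -> X).
Hypothesis hcont : forall i, continuous (f i).
Notation mu := (@lebesgue_measure R).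
Implicit Types (u : 'I_m -> R -> R) (x : R -> X) (T t h : R).

Definition control_variation u t : R :=
  \int[mu]_(s in `[0, t]) \sum_(i < m) `|u i s|.

Lemma within_continuous_rnorm x T : {within `[0, T], continuous x} ->
  forall s, 0 <= s -> s <= T -> forall e : R, 0 < e -> exists2 d : R, 0 < d &
  forall s', 0 <= s' -> s' <= T -> `|s - s'| < d -> rnorm (x s - x s') < e.
Proof.
move=> /subspace_continuousP cx s s0 sT e e0.
have /cx/cvg_rnormP/(_ e e0) : `[0, T]%classic s by rewrite /= in_itv /= s0 sT.
rewrite /= nbhs_simpl /= => -[d /= d0 Hd].
exists d => // s' s'0 s'T ss'; apply: Hd => //=.
by rewrite in_itv /= s'0.
Qed.

Lemma within_continuous_bounded x T : {within `[0, T], continuous x} ->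
  exists N : nat, forall s, 0 <= s -> s <= T -> rnorm (x s) <= N%:R.
Proof.
move=> /within_continuous_rnorm cx.
have xc s : 0 <= s -> s <= T -> forall e : R, 0 < e -> exists2 d : R, 0 < d &
    forall s', 0 <= s' -> s' <= T -> `|s - s'| < d -> rnorm (x s' - x s) < e.
  move=> s0 sT e e0; have [d d0 Hd] := cx s s0 sT e e0.
  by exists d => // s' s'0 s'T ss'; rewrite rnormB; exact: Hd.
have [h [h0 Hh]] : exists h : R, 0 < h /\ forall s s', 0 <= s -> s <= T ->
    0 <= s' -> s' <= T -> `|s - s'| < h -> rnorm (x s - x s') < 1.
  have [h [h0 Hh]] := filter_ex (filterI (nbhs_right_gt (0 : R))
    (unif_continuous_segment xc ltr01)).
  by exists h.
have H n s : 0 <= s -> s <= T -> s <= n%:R * (h / 2) -> rnorm (x s) <= rnorm (x 0) + n%:R.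
  elim: n s => [|n IH] s s0 sT.
    by rewrite mul0r mulr0n addr0 => s0'; suff -> : s = 0 by []; lra.
  rewrite -natr1 => sn; have [sh|hs] := leP s (h / 2).
    have := ler_rnormD (x s - x 0) (x 0); rewrite subrK.
    have : rnorm (x s - x 0) < 1.
      by apply: Hh => //; [lra|rewrite subr0 ger0_norm //; lra].
    by have : 0 <= n%:R :> R by []; lra.
  have sh0 : 0 <= s - h / 2 by lra.
  have h3 : rnorm (x (s - h / 2)) <= rnorm (x 0) + n%:R by apply: IH; lra.
  have := ler_rnormD (x s - x (s - h / 2)) (x (s - h / 2)).
  have : rnorm (x s - x (s - h / 2)) < 1.
    apply: Hh => //; first lra.
    by rewrite opprB addrC subrK ger0_norm; lra.
  by rewrite subrK; lra.
exists (Num.truncn (rnorm (x 0)) + (Num.truncn (T / (h / 2))).+1).+1 => s s0 sT.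
apply: le_trans (H (Num.truncn (T / (h / 2))).+1 s s0 sT _) _.
  have : T / (h / 2) < (Num.truncn (T / (h / 2))).+1%:R by exact: Num.Theory.truncnS_gt.
  by rewrite ltr_pdivrMr; lra.
have := Num.Theory.truncnS_gt (rnorm (x 0)).
by rewrite -addSn natrD; lra.
Qed.

Lemma mild_solution_riemann_sum u x xi0 T t (e : R) :
  (forall i, mu.-integrable `[0, T] (EFin \o u i)) ->
  mild_solution S f xi0 T u x -> 0 <= t -> t <= T -> 0 < e ->
  exists (n : nat) (s : nat -> R) (a : nat -> R) (c : 'I_m -> 'I_n -> R),
  [/\ forall j, (j < n)%N -> [/\ 0 <= s j, s j <= t & a j = control_variation u (s j)],
      forall j, 0 <= a j, a n = control_variation u t,
      forall j : 'I_n, \sum_(i < m) `|c i j| <= a j.+1 - a j &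
      rnorm (x t - S t xi0 - \sum_(i < m) \sum_(j < n)
        of_real k (c i j) *: S (t - s j) (f i (x (s j)))) <= e].
Proof.
move=> iu [cx mild] t0 tT e0.
have [|xbi xt] := mild t; first by rewrite in_itv /= t0.
pose D : set (measurableTypeR R) := `[0, t]%classic.
have mD : measurable D by exact: measurable_itv.
have iuD i : mu.-integrable D (EFin \o u i).
  by apply: integrableS (iu i) => //; apply: subset_itvl; rewrite bnd_simp.
have iauD i : mu.-integrable D (EFin \o (fun s => `|u i s|)).
  by have := integrable_abse (iuD i); apply: eq_integrable.
have [iw _] := @Rintegral_sum _ _ _ mu D mD _ (index_enum 'I_m)
    (fun i s => `|u i s|) (fun i _ => iauD i).
have Rint_sum (E : set (measurableTypeR R)) : measurable E -> E `<=` D ->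
    \sum_(i < m) \int[mu]_(s in E) `|u i s| = \int[mu]_(s in E) \sum_(i < m) `|u i s|.
  move=> mE ED; have iauE i := integrableS mD mE ED (iauD i).
  by have [_ ->] := @Rintegral_sum _ _ _ mu E mE _ (index_enum 'I_m)
    (fun i s => `|u i s|) (fun i _ => iauE i).
pose g i s := S (t - s) (f i (x s)).
have [M M1 HM] := semigroup_bounded_segment hS T.
have gc i s : 0 <= s -> s <= t -> forall e : R, 0 < e -> exists2 d : R, 0 < d &
    forall s', 0 <= s' -> s' <= t -> `|s - s'| < d -> rnorm (g i s' - g i s) < e.
  move=> s0 st e1 e10; have M0 : 0 < M by lra.
  have /nbhs_rnormP[d1 d10 Hd1] : \forall y \near x s, rnorm (f i (x s) - f i y) < e1 / 2 / M.
    have /cvg_rnormP/(_ (e1 / 2 / M)) := @hcont i (x s); apply.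
    by rewrite !divr_gt0.
  have [|d2 d20 Hd2] := within_continuous_rnorm cx s0 _ d10; first lra.
  have [|d3 d30 Hd3] := semigroup_unif_continuous hS T (f i (x s)) (e := e1 / 2); first lra.
  exists (Num.min d2 d3); first by rewrite lt_min d20.
  move=> s' s'0 s't; rewrite lt_min => /andP[ss2 ss3].
  have H1 : rnorm (x s - x s') < d1 by apply: Hd2 => //; lra.
  have H2 : rnorm (S (t - s') (f i (x s)) - S (t - s) (f i (x s))) < e1 / 2.
    by apply: Hd3; [lra..|rewrite (_ : t - s' - (t - s) = s - s') //; ring].
  have H3 : rnorm (g i s' - S (t - s') (f i (x s))) < e1 / 2.
    rewrite /g -semigroupB // ?subr_ge0 //.
    apply: le_lt_trans (HM _ _ _ _) _; [lra..|].
    by rewrite mulrC -ltr_pdivlMr // rnormB; exact: Hd1.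
  by have := ler_rnorm_distD (S (t - s') (f i (x s))) (g i s') (g i s); rewrite /g in H3 *; lra.
pose W := control_variation u t.
have W0 : 0 <= W by apply: Rintegral_ge0 => s _; apply: sumr_ge0.
pose eta := e / (W + 1).
have eta0 : 0 < eta by rewrite divr_gt0 //; lra.
have [h [h0 Hh]] : exists h : R, 0 < h /\ forall i s s', 0 <= s -> s <= t ->
    0 <= s' -> s' <= t -> `|s - s'| < h -> rnorm (g i s - g i s') < eta.
  have [h [h0 Hh]] := filter_ex (filterI (nbhs_right_gt (0 : R))
    (filter_forall _ (fun i => unif_continuous_segment (gc i) eta0))).
  by exists h; split => // i; exact: Hh.
pose n := (Num.truncn (t / h)).+1.
have tn : t < n%:R * h by rewrite -ltr_pdivrMr //; exact: Num.Theory.truncnS_gt.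
pose s j : R := j%:R * h.
have s_ge0 j : 0 <= s j by rewrite mulr_ge0 // ltW.
have s_le j : (j < n)%N -> s j <= t.
  rewrite ltnS => jn; rewrite -ler_pdivlMr //.
  have th0 : 0 <= t / h by rewrite divr_ge0 // ltW.
  by apply: le_trans (_ : (Num.truncn (t / h))%:R <= _);
    rewrite ?ler_nat // Num.Theory.truncn_le.
pose I j : set (measurableTypeR R) := `[s j, s j.+1[%classic.
have mI j : measurable (I j) by exact: measurable_itv.
pose a j := \int[mu]_(r in D `&` `[0, s j[%classic) \sum_(i < m) `|u i r|.
pose c i (j : 'I_n) := \int[mu]_(r in D `&` I j) u i r.
exists n, s, a, c; split.
- move=> j jn; split => //; first exact: s_le.
  rewrite /a /control_variation -Rintegral_itv_bndo_bndc; last first.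
    apply: integrableS iw => //.
    by move=> r; rewrite /D /I /= !in_itv /= => /andP[-> /ltW/le_trans]; apply; exact: s_le.
  congr (Rintegral _ _ _); apply/seteqP; split => r; rewrite /D /I /= !in_itv /=; first by case.
  move=> /andP[r0 rs]; rewrite r0 rs; split => //=.
  by apply/ltW/(lt_le_trans rs)/s_le.
- by move=> j; apply: Rintegral_ge0 => r _; apply: sumr_ge0.
- rewrite /a /control_variation; congr (Rintegral _ _ _).
  apply/seteqP; split => r; rewrite /D /I /= !in_itv /=; first by case.
  by move=> /andP[r0 rt]; rewrite r0 rt; split => //=; exact: le_lt_trans tn.
- move=> j.
  have -> : a j.+1 - a j = \int[mu]_(r in D `&` I j) \sum_(i < m) `|u i r|.
    have -> : a j.+1 = a j + \int[mu]_(r in D `&` I j) \sum_(i < m) `|u i r|; last by rewrite addrC addKr.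
    have e1 : D `&` `[0, s j.+1[ = (D `&` `[0, s j[) `|` (D `&` I j).
      apply/seteqP; split=> r; rewrite /D /I /= !in_itv /=.
        move=> [rD /andP[r0 rs]]; have [rj|rj] := ltP r (s j).
          by left; split => //; rewrite r0.
        by right; split.
      move=> [[rD /andP[r0 rs]]|[rD /andP[rs1 rs2]]]; split => //.
        by rewrite r0 (lt_trans rs) // ltr_pM2r // ltr_nat.
      by rewrite rs2 (le_trans _ rs1).
    rewrite /a e1 Rintegral_setU //.
    + exact: measurableI.
    + exact: measurableI.
    + by apply: integrableS iw => //; [apply: measurableU; apply: measurableI|rewrite -setIUr; exact: subIsetl].
    + apply/disj_setPS => r [[_ +] [_]]; rewrite /I /= !in_itv /= => /andP[_ rs].
      by rewrite leNgt rs.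
  rewrite -Rint_sum; [|exact: measurableI|exact: subIsetl].
  apply: ler_sum => i _; have mDI := measurableI _ _ mD (mI j); apply: le_normr_Rintegral => //.
  by apply: integrableS (iuD i) => //; exact: subIsetl.
have -> : x t - S t xi0 = \sum_(i < m) bochner_integral mu `[0, t]
    (fun r => of_real k (u i r) *: g i r) by rewrite xt addrC addKr.
rewrite -sumrB (le_trans (ler_rnorm_sum _ _ _)) //.
have -> : e = eta * (W + 1) by rewrite /eta divfK // gt_eqF //; lra.
apply: (@le_trans _ _ (\sum_(i < m) eta * \int[mu]_(r in D) `|u i r|)); last first.
  by rewrite -mulr_sumr Rint_sum // ler_wpM2l ?(ltW eta0) // lerDl.
apply: ler_sum => i _.
pose J := [seq (I j, g i (s j)) | j : 'I_n <- index_enum 'I_n].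
have := @bochner_integral_dist _ _ R mu D mD k X
  (fun r => of_real k (u i r) *: g i r) _ (u i) J eta _ (iuD i) _ (ltW eta0).
rewrite /J big_map; apply.
- rewrite /bochner_integral; have [v Hv] := xbi i.
  exact: (@xgetPex _ 0 [set v | is_bochner_integral mu D _ v] (ex_intro _ v Hv)).
- by move=> _ /mapP[j _ ->]; exact: mI.
move=> r; rewrite /D /= in_itv /= => /andP[r0 rt].
rewrite big_map.
have rh0 : 0 <= r / h by rewrite divr_ge0 // ltW.
have jr_le : s (Num.truncn (r / h)) <= r by rewrite -ler_pdivlMr // Num.Theory.truncn_le.
have jr_gt : r < s (Num.truncn (r / h)).+1.
  by rewrite -ltr_pdivrMr // Num.Theory.truncnS_gt.
have jn : (Num.truncn (r / h) < n)%N.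
  rewrite -(ltr_nat R) -(ltr_pM2r h0); exact: le_lt_trans jr_le (le_lt_trans rt tn).
rewrite (bigD1 (Ordinal jn)) //= big1 => [|j jr].
  rewrite addr0 indicE mem_set; last by rewrite /I /= in_itv /= jr_le.
  rewrite mul1r -scalerBr rnormZ mulrC ler_wpM2r //; apply/ltW/Hh => //.
    exact: s_le.
  by rewrite ger0_norm ?subr_ge0 // ltrBlDr -[X in X + _]mul1r -mulrDl nat1r.
rewrite indicE memNset ?mul0r ?of_real0 ?scale0r //.
rewrite /I /= in_itv /= => /andP[jr1 jr2]; move/eqP: jr; apply; apply/val_inj => /=.
apply/eqP; rewrite eqn_leq; apply/andP; split; rewrite -ltnS -(ltr_nat R) -(ltr_pM2r h0).
  exact: le_lt_trans jr1 jr_gt.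
exact: le_lt_trans jr_le jr2.
Qed.

End MildSolution.

(** * Covering radii *)

Section CoveringCalculus.
Context (R : realType) (k : scalar_kind).
Variable X : completeNormedModType (scalar R k).
Implicit Types (Q G A B : set X) (x y z : X) (r e : R).

Lemma covered_le Q r r' : r <= r' -> covered Q r -> covered Q r'.
Proof.
by move=> rr' [F HF]; exists F => x /HF[y yF xy]; exists y => //; exact: le_trans rr'.
Qed.

Lemma covered_subset Q Q' r : Q `<=` Q' -> covered Q' r -> covered Q r.
Proof. by move=> QQ' [F HF]; exists F => x /QQ'/HF. Qed.

Lemma covered_add A B Q r r' e : covered A r -> covered B r' ->
  (forall x, Q x -> exists y z, [/\ A y, B z & rnorm (x - (y + z)) <= e]) ->
  covered Q (r + r' + e).
Proof.
move=> [F HF] [F' HF'] HQ; exists [seq y + z | y <- F, z <- F'].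
move=> x /HQ[y [z [/HF[y' yF yy'] /HF'[z' zF zz'] xyz]]].
exists (y' + z'); first by apply/allpairsP; exists (y', z').
have -> : x - (y' + z') = (x - (y + z)) + ((y - y') + (z - z')).
  by rewrite [X in _ = _ + X]addrACA -opprD addrA subrK.
by have := ler_rnormD (x - (y + z)) ((y - y') + (z - z'));
  have := ler_rnormD (y - y') (z - z'); lra.
Qed.

Lemma covered_internal Q r : covered Q r -> exists F : seq X,
  (forall y, y \in F -> Q y) /\
  forall x, Q x -> exists2 y, y \in F & rnorm (x - y) <= r + r.
Proof.
move=> [F HF].
have /choice[phi Hphi] : forall y, exists x, (exists2 q, Q q & rnorm (q - y) <= r) ->
    Q x /\ rnorm (x - y) <= r.
  move=> y; have [[q Qq qy]|nq] := pselect (exists2 q, Q q & rnorm (q - y) <= r).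
    by exists q.
  by exists 0.
exists [seq phi y | y <- F & `[< exists2 q, Q q & rnorm (q - y) <= r >]]; split.
  by move=> _ /mapP[y + ->]; rewrite mem_filter => /andP[/asboolP/Hphi[]].
move=> x Qx; have [y yF xy] := HF x Qx.
have hy : exists2 q, Q q & rnorm (q - y) <= r by exists x.
exists (phi y); first by apply: map_f; rewrite mem_filter yF andbT; exact/asboolP.
have [_ phiy] := Hphi y hy.
by have := ler_rnorm_distD y x (phi y); rewrite (rnormB y); lra.
Qed.

Lemma covered_lipschitz Q r (g : X -> X) (L : R) : 0 <= L ->
  (forall x y, Q x -> Q y -> rnorm (g x - g y) <= L * rnorm (x - y)) ->
  covered Q r -> covered (g @` Q) (L * (r + r)).
Proof.
move=> L0 gL /covered_internal[F [FQ HF]]; exists [seq g y | y <- F].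
move=> _ [x Qx <-]; have [y yF xy] := HF x Qx.
exists (g y); first exact: map_f.
by apply: le_trans (gL _ _ Qx (FQ _ yF)) _; rewrite ler_wpM2l.
Qed.

Lemma covered_bigcup (I : finType) (Q : I -> set X) r :
  (forall i, covered (Q i) r) -> covered (\bigcup_i Q i) r.
Proof.
move=> /choice[F HF]; exists (flatten [seq F i | i <- enum I]).
move=> x [i _ /HF[y yF xy]]; exists y => //.
by apply/flatten_mapP; exists i => //; rewrite mem_enum.
Qed.

Lemma totally_bounded_segment y (b : R) : 0 <= b ->
  totally_bounded [set of_real k a *: y | a in [set a : R | `|a| <= b]].
Proof.
move=> b0 e e0; pose d := e / (rnorm y + 1).
have y1 : 0 < rnorm y + 1 by have := rnorm_ge0 y; lra.
have d0 : 0 < d by rewrite divr_gt0.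
pose h (j : nat) : X := of_real k (j%:R * d - b) *: y.
exists [seq h j | j <- iota 0 (Num.truncn ((b + b) / d)).+1].
move=> _ [a ab <-]; have [ab1 ab2] : - b <= a /\ a <= b.
  by move: ab; rewrite /= ler_norml => /andP[].
have q0 : 0 <= (a + b) / d by rewrite divr_ge0 ?(ltW d0) //; lra.
have /andP[j1 j2] := Num.Theory.truncn_itv q0.
set j := Num.truncn ((a + b) / d) in j1 j2.
exists (h j).
  apply: map_f.
  rewrite mem_iota /= add0n ltnS /j; apply: Num.Theory.le_truncn.
  by rewrite ler_pM2r ?invr_gt0 //; lra.
rewrite /h -scalerBl -of_realN -of_realD rnormZ.
rewrite ler_pdivlMr // in j1; rewrite ltr_pdivrMr // -natr1 in j2.
have : `|a - (j%:R * d - b)| <= d by rewrite ger0_norm; lra.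
move=> /(ler_wpM2r (rnorm_ge0 y)) /le_trans; apply.
have : d * (rnorm y + 1) = e by rewrite /d divfK // gt_eqF.
lra.
Qed.

Lemma totally_bounded_span (n : nat) (F : nat -> X) (b : R) : 0 <= b ->
  totally_bounded [set z | exists d : nat -> R, (forall j, `|d j| <= b) /\
    z = \sum_(j < n) of_real k (d j) *: F j].
Proof.
move=> b0; elim: n => [|n IH] e e0.
  exists [:: 0] => x [d [_ ->]]; exists 0; first by rewrite mem_head.
  by rewrite big_ord0 subrr rnorm0 ltW.
have e20 : 0 < e / 2 by lra.
have -> : e = e / 2 + e / 2 + 0 by lra.
apply: covered_add (IH _ e20) (totally_bounded_segment (F n) b0 e20) _.
move=> x [d [db ->]]; exists (\sum_(j < n) of_real k (d j) *: F j), (of_real k (d n) *: F n).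
split; [by exists d|by exists (d n); rewrite /=|].
by rewrite big_ord_recr /= subrr rnorm0.
Qed.

Definition combinations G (b : R) : set X :=
  [set z | exists (I : finType) (P : pred I) (c : I -> R) (g : I -> X),
    [/\ forall i, P i -> G (g i), \sum_(i | P i) `|c i| <= b &
        z = \sum_(i | P i) of_real k (c i) *: g i]].

Lemma covered_combinations G (b r e : R) : 0 <= b -> 0 <= r -> 0 < e ->
  covered G r -> covered (combinations G b) (b * r + e).
Proof.
move=> b0 r0 e0 [F HF].
have [C HC] := totally_bounded_span (size F) (nth 0 F) b0 e0.
exists C => _ [I [P [c [g [gG cb ->]]]]].
have /choice[phi Hphi] : forall i, exists j, P i -> (j < size F)%N /\ rnorm (g i - F`_j) <= r.
  move=> i; have [Pi|_] := boolP (P i); last by exists 0%N.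
  have [y yF gy] := HF _ (gG i Pi).
  by exists (index y F) => _; rewrite index_mem nth_index.
pose d j := \sum_(i | P i && (phi i == j)) c i.
have db j : `|d j| <= b.
  apply: le_trans (ler_norm_sum _ _ _) _; apply: le_trans cb.
  rewrite [leRHS](bigID (fun i => phi i == j)) /= lerDl.
  by apply: sumr_ge0.
have [|y yC zy] := HC (\sum_(j < size F) of_real k (d j) *: F`_j); first by exists d.
exists y => //; have := ler_rnorm_distD (\sum_(j < size F) of_real k (d j) *: F`_j)
  (\sum_(i | P i) of_real k (c i) *: g i) y.
move=> /le_trans; apply; apply: lerD => //.
have -> : \sum_(j < size F) of_real k (d j) *: F`_j =
    \sum_(i | P i) of_real k (c i) *: F`_(phi i).
  have of_real_sum (J : finType) (Q : pred J) (h : J -> R) :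
      of_real k (\sum_(i | Q i) h i) = \sum_(i | Q i) of_real k (h i).
    by apply: (big_morph _ (@of_realD R k) (of_real0 R k)).
  under eq_bigr do rewrite of_real_sum scaler_suml.
  rewrite (exchange_big_dep P) /=; last by move=> j i _ /andP[].
  apply: eq_bigr => i Pi; have [lt_i _] := Hphi i Pi.
  rewrite (bigD1 (Ordinal lt_i)) /=; last by rewrite Pi eqxx.
  rewrite big1 ?addr0 // => j /andP[/andP[_ /eqP ij]] /eqP[].
  exact: val_inj.
rewrite -sumrB; apply: le_trans (ler_rnorm_sum _ _ _) _.
apply: (@le_trans _ _ (\sum_(i | P i) `|c i| * r)).
  apply: ler_sum => i Pi; rewrite -scalerBr rnormZ ler_wpM2l //.
  by have [] := Hphi i Pi.
by rewrite -mulr_suml ler_wpM2r.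
Qed.

End CoveringCalculus.

(** * Contraction of the covering radius *)

Lemma sum_increments_ge (R : realType) (n : nat) (a : nat -> R) (c : R) :
  (forall j, (j < n)%N -> a j <= a j.+1) ->
  \sum_(j < n | c <= a j) (a j.+1 - a j) <= Num.max (a n - c) 0.
Proof.
elim: n => [|n IH] an; first by rewrite big_ord0 le_max lexx orbT.
have an1 := an n (ltnSn n).
have {}IH := IH (fun j jn => an j (ltnW jn)).
rewrite big_mkcond big_ord_recr /= -big_mkcond /=.
apply: le_trans (lerD IH (lexx _)) _.
by rewrite !maxEle; case: ifP; case: ifP; case: ifP; lra.
Qed.

Section Contraction.
Context (R : realType) (k : scalar_kind).
Variables (X : completeNormedModType (scalar R k)) (S : R -> X -> X).
Hypothesis hS : C0_semigroup S.
Variables (m : nat) (f : 'I_m -> X -> X).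
Hypothesis hcont : forall i, continuous (f i).
Hypothesis hlip : forall i, lipschitz_on_bounded_sets (f i).
Variable xi0 : X.
Notation mu := (@lebesgue_measure R).
Implicit Types (u : 'I_m -> R -> R) (x : R -> X) (T t r : R).

Lemma lipschitz_on_ball (N : R) : exists2 L : R, 0 <= L & forall i y z,
  rnorm y <= N -> rnorm z <= N -> rnorm (f i y - f i z) <= L * rnorm (y - z).
Proof.
have H i : exists L : R, 0 <= L /\ forall y z,
    rnorm y <= N -> rnorm z <= N -> rnorm (f i y - f i z) <= L * rnorm (y - z).
  have bN : bounded_set [set y : X | rnorm y <= N].
    exists (of_real k N); split.
      by rewrite realE -!(of_real0 R k) !ler_of_real -!realE num_real.
    move=> M NM y /= yN; apply: ltW; apply: le_lt_trans NM.
    by rewrite -of_real_rnorm ler_of_real.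
  have [L L0 HL] := hlip i bN.
  exists (real_part L); split.
    by rewrite -(ler_of_real k) of_real0 real_partK.
  move=> y z yN zN; rewrite -(ler_of_real k) of_realM real_partK // !of_real_rnorm.
  exact: (HL (y, z)).
have [L HL] := choice H.
exists (\sum_i L i); first by apply: sumr_ge0 => i _; have [] := HL i.
move=> i y z yN zN; have [_ /(_ y z yN zN)/le_trans] := HL i; apply.
rewrite ler_wpM2r ?rnorm_ge0 // (bigD1 i) //= lerDl.
by apply: sumr_ge0 => j _; have [] := HL j.
Qed.

Lemma covered_orbit (G : set X) (T M r e : R) : 1 <= M ->
  (forall t z, 0 <= t -> t <= T -> rnorm (S t z) <= M * rnorm z) ->
  0 < e -> covered G r ->
  covered [set z | exists t y, [/\ 0 <= t, t <= T, G y & z = S t y]] (M * r + e).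
Proof.
move=> M1 HM e0 [F HF].
have [C HC] : exists C : seq X, forall y, y \in F -> forall t, 0 <= t -> t <= T ->
    exists2 z, z \in C & rnorm (S t y - z) <= e.
  elim: (F) => [|y F' [C HC]]; first by exists [::].
  have [d d0 Hd] := semigroup_unif_continuous hS T y e0.
  pose h (j : nat) : X := S (j%:R * d) y.
  exists ([seq h j | j <- iota 0 (Num.truncn (T / d)).+1] ++ C).
  move=> y'; rewrite inE => /orP[/eqP ->|y'F] t t0 tT; last first.
    by have [z zC tz] := HC _ y'F t t0 tT; exists z; rewrite // mem_cat zC orbT.
  have td : 0 <= t / d by rewrite divr_ge0 // ltW.
  have /andP[j1 j2] := Num.Theory.truncn_itv td.
  rewrite ler_pdivlMr // in j1; rewrite ltr_pdivrMr // -natr1 in j2.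
  exists (h (Num.truncn (t / d))).
    rewrite mem_cat; apply/orP; left; apply: map_f.
    rewrite mem_iota /= add0n ltnS; apply: Num.Theory.le_truncn.
    by rewrite ler_pM2r ?invr_gt0.
  apply/ltW/Hd => //.
  - by rewrite mulr_ge0 // ltW.
  - exact: le_trans tT.
  - by rewrite ger0_norm; lra.
exists C => _ [t [y [t0 tT Gy ->]]].
have [z zF yz] := HF y Gy; have [w wC zw] := HC z zF t t0 tT.
exists w => //; apply: le_trans (ler_rnorm_distD (S t z) _ _) _; apply: lerD => //.
rewrite -semigroupB //; apply: le_trans (HM _ _ t0 tT) _.
by rewrite ler_wpM2l //; lra.
Qed.

Definition bounded_reach (N sigma : R) : set X :=
  [set y | exists T u x t,
    [/\ forall i, mu.-integrable `[0, T] (EFin \o u i),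
        mild_solution S f xi0 T u x, [/\ 0 <= t, t <= T & t <= N],
        forall s, 0 <= s -> s <= t -> rnorm (x s) <= N &
        control_variation u t < sigma /\ y = x t]].

(* The times [s] with [control_variation u s < sigma] contribute the second term,
   the later ones the third. *)
Lemma bounded_reach_decomposition (N sigma delta e : R) y :
  0 <= N -> 0 <= sigma -> 0 < delta -> 0 < e ->
  let orbit G := [set z | exists t y', [/\ 0 <= t, t <= N, G y' & z = S t y']] in
  let image Q := \bigcup_i (f i @` Q) in
  bounded_reach N (sigma + delta) y ->
  exists y0 y1 y2, [/\ orbit [set xi0] y0,
    combinations (orbit (image (bounded_reach N sigma))) (sigma + delta) y1,
    combinations (orbit (image (bounded_reach N (sigma + delta)))) delta y2 &
    rnorm (y - (y0 + y1 + y2)) <= e].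
Proof.
move=> N0 sigma0 delta0 e0 orbit image.
move=> [T [u [x [t [iu mild [t0 tT tN] xN [vt ->]]]]]].
have [n [s [a [c [sP a0 an ca He]]]]] :=
  mild_solution_riemann_sum hS hcont iu mild t0 tT e0.
have incr j : (j < n)%N -> a j <= a j.+1.
  by move=> jn; rewrite -subr_ge0 (le_trans _ (ca (Ordinal jn))) // sumr_ge0.
have a_le j : (j <= n)%N -> a j <= a n.
  move=> jn; rewrite -subr_ge0 -(telescope_sumr a jn).
  rewrite big_nat; apply: sumr_ge0 => l /andP[_ ln].
  by rewrite subr_ge0; exact: incr.
pose P (p : 'I_m * 'I_n) := sigma <= a p.2.
pose c' (p : 'I_m * 'I_n) := c p.1 p.2.
pose g (p : 'I_m * 'I_n) := S (t - s p.2) (f p.1 (x (s p.2))).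
have gP sigma' (p : 'I_m * 'I_n) : a p.2 < sigma' ->
    orbit (image (bounded_reach N sigma')) (g p).
  case: p => i j /= aj; have [sj0 sjt ajv] := sP j (ltn_ord j).
  exists (t - s j), (f i (x (s j))); split => //; [lra|lra|].
  exists i => //; exists (x (s j)) => //.
  exists T, u, x, (s j); split=> //; first by split => //; lra.
    by move=> r r0 rs; apply: xN => //; lra.
  by rewrite -ajv.
have csum (Q : pred 'I_n) : \sum_(p : 'I_m * 'I_n | Q p.2) `|c' p| <=
    \sum_(j < n | Q j) (a j.+1 - a j).
  rewrite -(pair_big xpredT Q (fun i j => `|c i j|)) /= exchange_big /=.
  by apply: ler_sum => j _; exact: ca.
exists (S t xi0), (\sum_(p | ~~ P p) of_real k (c' p) *: g p),
  (\sum_(p | P p) of_real k (c' p) *: g p); split.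
- by exists t, xi0.
- exists ('I_m * 'I_n)%type, (fun p => ~~ P p), c', g; split => //.
    by move=> p; rewrite /P -ltNge => /gP.
  apply: le_trans (csum (fun j => ~~ (sigma <= a j))) _.
  apply: (@le_trans _ _ (\sum_(j < n) (a j.+1 - a j))).
    rewrite [leRHS](bigID (fun j : 'I_n => sigma <= a j)) /= lerDr.
    by apply: sumr_ge0 => j _; rewrite subr_ge0; exact: incr.
  rewrite -(big_mkord xpredT (fun j => a j.+1 - a j)) telescope_sumr //.
  by have := a0 0%N; lra.
- exists ('I_m * 'I_n)%type, P, c', g; split => //.
    move=> p _; apply: gP; apply: le_lt_trans (a_le _ (ltnW (ltn_ord p.2))) _.
    by rewrite an.
  apply: le_trans (csum (fun j => sigma <= a j)) _.
  apply: le_trans (sum_increments_ge sigma incr) _.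
  by rewrite ge_max; apply/andP; split; lra.
- have := He; rewrite pair_big (bigID P) /= => /(le_trans _); apply.
  rewrite le_eqVlt; apply/orP; left; apply/eqP; congr rnorm.
  by rewrite !opprD !addrA addrAC.
Qed.

Lemma totally_bounded_reach_step (N sigma delta M L : R) : 0 <= N -> 0 <= sigma -> 1 <= M ->
  (forall t z, 0 <= t -> t <= N -> rnorm (S t z) <= M * rnorm z) -> 0 <= L ->
  (forall i y z, rnorm y <= N -> rnorm z <= N -> rnorm (f i y - f i z) <= L * rnorm (y - z)) ->
  0 < delta -> 16 * (delta * (2 * M * L + 1)) <= 1 ->
  totally_bounded (bounded_reach N sigma) ->
  totally_bounded (bounded_reach N (sigma + delta)).
Proof.
move=> N0 sigma0 M1 HM L0 HL delta0 deltaML tQ.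
pose orbit G := [set z | exists t y', [/\ 0 <= t, t <= N, G y' & z = S t y']].
pose image Q := \bigcup_i (f i @` Q).
have reach_ball s y : bounded_reach N s y -> rnorm y <= N.
  by move=> [T [u [x [t [_ _ [t0 _ _] xN [_ ->]]]]]]; exact: xN.
have cov_image s r : covered (bounded_reach N s) r ->
    covered (image (bounded_reach N s)) (L * (r + r)).
  move=> cr; apply: covered_bigcup => i; apply: covered_lipschitz => // y z Qy Qz.
  by apply: HL; apply: reach_ball; [exact: Qy|exact: Qz].
have cov_orbit G r e : 0 < e -> covered G r -> covered (orbit G) (M * r + e).
  by move=> e0; exact: covered_orbit.
pose K := 2 * M * L + 1.
have K1 : 1 <= K by rewrite lerDr !mulr_ge0 //; lra.
have cov_orbit_image s r : 0 < r -> covered (bounded_reach N s) r ->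
    covered (orbit (image (bounded_reach N s))) (K * r).
  move=> r0 /cov_image/(cov_orbit _ _ r r0); apply: covered_le.
  by rewrite /K; lra.
have cov_comb s b r e : 0 <= b -> 0 < r -> 0 < e -> covered (bounded_reach N s) r ->
    covered (combinations (orbit (image (bounded_reach N s))) b) (b * (K * r) + e).
  move=> b0 r0 e0 cr; apply: covered_combinations => //; last exact: cov_orbit_image.
  by rewrite mulr_ge0 //; lra.
have cov0 e : 0 < e -> covered (orbit [set xi0]) e.
  move=> e0; have -> : e = M * 0 + e by rewrite mulr0 add0r.
  apply: cov_orbit => //; exists [:: xi0] => _ ->.
  by exists xi0; rewrite ?mem_head // subrr rnorm0.
have sd0 : 0 < sigma + delta by lra.
have covA e : 0 < e ->
    covered (combinations (orbit (image (bounded_reach N sigma))) (sigma + delta)) e.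
  move=> e0; pose b := sigma + delta.
  have bK0 : 0 < b * K by rewrite mulr_gt0 //; lra.
  pose q := e / 2 / (b * K); have q0 : 0 < q by rewrite !divr_gt0.
  have -> : e = b * (K * q) + e / 2.
    by rewrite mulrA /q [_ * (_ / _)]mulrC divfK ?gt_eqF //; lra.
  by apply: cov_comb => //; [exact: ltW|lra|exact: tQ].
have half r : 0 < r -> covered (bounded_reach N (sigma + delta)) r ->
    covered (bounded_reach N (sigma + delta)) (r / 2).
  move=> r0 cr; have r8 : 0 < r / 8 by lra.
  have covB : covered (combinations (orbit (image (bounded_reach N (sigma + delta)))) delta)
      (r / 8).
    have r16 : 0 < r / 16 by lra.
    apply: covered_le (cov_comb _ _ r _ (ltW delta0) r0 r16 cr).
    rewrite mulrA; suff : delta * K * r <= r / 16 by lra.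
    by have := ler_wpM2r (ltW r0) deltaML; rewrite -/K; lra.
  pose AB := [set z | exists y0 y1, [/\ orbit [set xi0] y0,
    combinations (orbit (image (bounded_reach N sigma))) (sigma + delta) y1 &
    z = y0 + y1]].
  have covAB : covered AB (r / 8 + r / 8 + 0).
    apply: covered_add (cov0 _ r8) (covA _ r8) _ => _ [y0 [y1 [Ay0 Ay1 ->]]].
    by exists y0, y1; split => //; rewrite subrr rnorm0.
  have -> : r / 2 = r / 8 + r / 8 + 0 + r / 8 + r / 8 by lra.
  apply: covered_add covAB covB _ => y Qy.
  have [y0 [y1 [y2 [h0 h1 h2 h]]]] :=
    bounded_reach_decomposition N0 sigma0 delta0 r8 Qy.
  by exists (y0 + y1), y2; split => //; exists y0, y1.
have iter n : covered (bounded_reach N (sigma + delta)) ((N + 1) * 2^-1 ^+ n).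
  elim: n => [|n IH].
    exists [:: 0] => y /reach_ball yN; exists 0; first by rewrite mem_head.
    by rewrite subr0 expr0; lra.
  by rewrite exprSr mulrA; apply: half => //; rewrite mulr_gt0 ?exprn_gt0 //; lra.
move=> e e0; have [n Hn] := geometric_half_small (N + 1) e0.
exact: covered_le (ltW (Hn n (leqnn n))) (iter n).
Qed.

Lemma totally_bounded_reach (N sigma : R) : 0 <= N -> totally_bounded (bounded_reach N sigma).
Proof.
move=> N0; have [M M1 HM] := semigroup_bounded_segment hS N.
have [L L0 HL] := lipschitz_on_ball N.
pose delta := (16 * (2 * M * L + 1))^-1.
have K0 : 0 < 2 * M * L + 1 by have : 0 <= M * L by [rewrite mulr_ge0 //; lra]; lra.
have delta0 : 0 < delta by rewrite invr_gt0 mulr_gt0.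
have H j : totally_bounded (bounded_reach N (j%:R * delta)).
  elim: j => [|j IH].
    move=> e e0; exists [::] => y [T [u [x [t [_ _ _ _ [+ _]]]]]].
    rewrite mul0r ltNge Rintegral_ge0 // => r _.
    exact: sumr_ge0.
  rewrite -natr1 mulrDl mul1r.
  apply: (totally_bounded_reach_step N0 _ M1 HM L0 HL delta0 _ IH).
    by rewrite mulr_ge0 // ltW.
  by rewrite mulrCA /delta mulVf // gt_eqF // mulr_gt0.
move=> e e0; apply: covered_subset (H (Num.truncn (sigma / delta)).+1 e e0).
move=> y [T [u [x [t [iu mild h xN [vt ->]]]]]]; exists T, u, x, t; split => //.
split => //; apply: lt_trans vt _.
by rewrite -ltr_pdivrMr //; exact: Num.Theory.truncnS_gt.
Qed.

End Contraction.

Theorem corollary3p3 (R : realType) (k : scalar_kind)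
    (X : completeNormedModType (scalar R k))
    (S : R -> X -> X) (domA : set X) (A : X -> X)
    (hS : C0_semigroup S) (hA : infinitesimal_generator S domA A)
    (p : \bar R) (hp : (1 < p)%E)
    (m : nat) (f : 'I_m -> X -> X)
    (hcont : forall i, continuous (f i))
    (hlip : forall i, lipschitz_on_bounded_sets (f i))
    (hlin : forall i, linearly_bounded (f i))
    (xi0 : X) :
  (exists C : nat -> set X,
     (forall n, relatively_compact (C n)) /\
     reachable_set S p f xi0 = \bigcup_n C n) /\
  (~ finite_dimensional X -> (reachable_set S p f xi0)° = set0).
Proof.
pose C (n : nat) : set X :=
  reachable_set S p f xi0 `&` bounded_reach S f xi0 n%:R n%:R.
have rcC n : relatively_compact (C n).
  apply: totally_bounded_relatively_compact => e e0.
  apply: (@covered_subset _ _ _ _ (bounded_reach S f xi0 n%:R n%:R)); first by move=> y [].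
  exact: totally_bounded_reach.
have reachC : reachable_set S p f xi0 = \bigcup_n C n.
  apply/seteqP; split=> [y reach_y|y [n _ []] //].
  have [T _ [u [x [t [up mild]]]]] := reach_y; rewrite in_itv /= => /andP[t0 tT] yt.
  have [N HN] := within_continuous_bounded mild.1.
  pose n := (N + (Num.truncn t).+1 + (Num.truncn (control_variation u t)).+1)%N.
  exists n => //; split => //; exists T, u, x, t; split => //.
  - by move=> i; exact: Lp_control_integrable up.
  - split => //; apply: le_trans (ltW (Num.Theory.truncnS_gt t)) _.
    by rewrite ler_nat /n -addnA addnCA leq_addr.
  - move=> s s0 st; apply: le_trans (HN s s0 (le_trans st tT)) _.
    by rewrite ler_nat /n -addnA leq_addr.
  - split => //; apply: lt_le_trans (Num.Theory.truncnS_gt _) _.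
    by rewrite ler_nat leq_addl.
split; first by exists C.
by rewrite reachC => nfd; exact: interior_bigcup_relatively_compact.
Qed.
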